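(* If $f:\mathbb{R}\to\mathbb{R}$ is a partial function whose range is not dense in $\mathbb{R}$ (with the Cantor space topology), then $f$ is infinite time computable if and only if $f$ is one-tape computable.
   Context: $\mathbb{R}=2^\omega$ with the product (Cantor space) topology. An infinite time Turing machine (ITTM) has three tapes (input, scratch, output) of cells indexed by $\omega$ with values in $\{0,1\}$, one head scanning a column of all three tapes, and a program with finitely many states including start, halt and a limit state. Successor steps are as for ordinary Turing machines (moving left from the leftmost cell leaves the head in place); at limit stages the head returns to the leftmost cell, the state becomes the limit state, and each cell takes the $\limsup$ of its earlier values. On input $a$, $a$ is on the input tape and other tapes are $0$; upon halting the output is the output tape. $f$ is (infinite time) computable if some program on input $a$ halts iff $a\in\mathrm{dom}(f)$, with output $f(a)$. A one-tape ITTM is the same with a single tape that initially holds the input and whose whole contents are the output upon halting; one-tape computable is defined analogously. *)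

(* Defs.v *)
From HB Require Import structures.
From mathcomp Require Import all_boot all_order all_algebra.
From mathcomp Require Import all_classical all_reals all_analysis.
Set Implicit Arguments. Unset Strict Implicit. Unset Printing Implicit Defensive.

(* Infinite time Turing machines with k tapes (cells indexed by nat, values in
   bool), one head scanning a column of all k tapes. *)

Record program (k : nat) := Program {
  state : finType;
  q_start : state;
  q_halt : state;
  q_limit : state;
  (* transition: current state, scanned column |->
     new state, column written, move (true = right, false = left) *)
  delta : state -> {ffun 'I_k -> bool} -> state * {ffun 'I_k -> bool} * bool
}.

Record config (k : nat) (P : program k) := Config {
  cst : state P;
  chead : nat;
  ctape : nat -> 'I_k -> bool
}.

(* successor step; moving left from cell 0 leaves the head in place (0.-1 = 0) *)
Definition step (k : nat) (P : program k) (c : config P) : config P :=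
  let col := [ffun i => ctape c (chead c) i] in
  let: (q', w, r) := delta (cst c) col in
  Config q' (if r then (chead c).+1 else (chead c).-1)
    (fun n i => if n == chead c then w i else ctape c n i).

(* A halting run of P from the configuration [init], ending in configuration
   [fin]: a well-ordered set of times (T, lt) with a last element [tend],
   configurations c : T -> config satisfying the initial, successor and limit
   rules (at limits: limit state, head on cell 0, each cell the limsup of its
   earlier values), and the halt state reached exactly at the last time. *)
Definition halting_run (k : nat) (P : program k) (init fin : config P) : Prop :=
  exists (T : Type) (lt : T -> T -> Prop) (c : T -> config P) (tend : T),
    well_founded lt /\
        (forall x y z, lt x y -> lt y z -> lt x z) /\
        (forall x y, [\/ lt x y, x = y | lt y x]) /\
        (forall t, t = tend \/ lt t tend) /\
        (forall t, (forall s, ~ lt s t) -> c t = init) /\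
        (forall s t, lt s t -> (forall u, ~ (lt s u /\ lt u t)) ->
            c t = step (c s)) /\
        (forall t, (exists s, lt s t) ->
            (forall s, lt s t -> exists u, lt s u /\ lt u t) ->
            c t = Config (q_limit P) 0
                    (fun n i => `[< forall s, lt s t ->
                        exists u, (s = u \/ lt s u) /\ lt u t /\
                                  ctape (c u) n i >])) /\
        (forall t, lt t tend -> cst (c t) <> q_halt P)
      /\ (cst (c tend) = q_halt P /\ c tend = fin).

(* Three-tape machines: tape 0 = input, tape 1 = scratch, tape 2 = output. *)
Definition tape_in : 'I_3 := @Ordinal 3 0 isT.
Definition tape_out : 'I_3 := @Ordinal 3 2 isT.

Definition init3 (P : program 3) (a : nat -> bool) : config P :=
  Config (q_start P) 0 (fun n i => if i == tape_in then a n else false).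

Definition ittm_computes (P : program 3) (a b : nat -> bool) : Prop :=
  exists fin : config P, halting_run (init3 P a) fin /\
    (forall n, b n = ctape fin n tape_out).

Definition init1 (P : program 1) (a : nat -> bool) : config P :=
  Config (q_start P) 0 (fun n _ => a n).

Definition ittm1_computes (P : program 1) (a b : nat -> bool) : Prop :=
  exists fin : config P, halting_run (init1 P a) fin /\
    (forall n, b n = ctape fin n ord0).

(* Partial functions on Cantor space R = 2^omega, as option-valued maps;
   dom f = [set a | f a <> None]. *)
Definition pfun := cantor_space -> option cantor_space.

Definition prange (f : pfun) : set cantor_space :=
  [set y | exists a, f a = Some y].

Definition ittm_computable (f : pfun) : Prop :=
  exists P : program 3, forall a b, ittm_computes P a b <-> f a = Some b.

Definition one_tape_computable (f : pfun) : Prop :=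
  exists P : program 1, forall a b, ittm1_computes P a b <-> f a = Some b.

(* Main.v *)
(* A one-tape machine forgets everything but its tape at a limit, and it may
   halt only with the output alone on its tape; so it must recognise from the
   tape itself whether a limit ends the decoding of the output. Since the range
   of [f] is not dense, there is a finite word [s] that no value of [f] extends.
   The one-tape machine keeps [s] in front of an interleaved copy of the three
   tapes and, at each limit, halts when the tape does not start with [s].
   - Setup (omega^2 steps): phase [n] shifts the tape to make room for the block
     of the [n]-th input bit. A flag cell set and reset once per phase is 0 at
     the end of each phase but 1 at their limit, where simulation starts.
   - Simulation: a step takes finitely many steps, in which every cell shows
     its old or its new value, so the limsups are the right ones.
   - Decoding (omega steps): the output bits are moved to the front one by one.
   Conversely three tapes simulate one tape step by step, after copying the
   input onto the output tape.

   Runs are concatenated along well-orders. If the simulating machine halts but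
   the simulated one does not, run the latter along the halting well-order [T]
   of the former: this yields a run without halt of the former into which [T]
   embeds, contradicting the comparability of runs. *)
Require Import Defs.
From HB Require Import structures.
From mathcomp Require Import all_boot all_order all_algebra.
From mathcomp Require Import all_classical all_reals all_analysis.
From mathcomp Require Import zify.
From Stdlib Require Import Relation_Operators Lexicographic_Product.
Set Implicit Arguments. Unset Strict Implicit. Unset Printing Implicit Defensive.

(** * Histories along well-orders *)

Definition well_order (T : Type) (lt : T -> T -> Prop) : Prop :=
  [/\ well_founded lt, forall x y z, lt x y -> lt y z -> lt x z
    & forall x y, [\/ lt x y, x = y | lt y x]].

(** A position may stand for a whole stretch of computation, in which a cell can show both values;
    [A u] therefore records the cells showing a 1 somewhere in it, which is all that a limsup
    sees. *)
Definition limit_config (k : nat) (P : program k) (T : Type)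
    (lt : T -> T -> Prop) (A : T -> nat -> 'I_k -> Prop) (D : T -> Prop) :
    config P :=
  Config (q_limit P) 0
    (fun n i => `[< forall s, D s ->
                    exists u, (s = u \/ lt s u) /\ D u /\ A u n i >]).

(* [x] is the configuration that comes right after the history [D], where
   position [s] of the history exits into [N s] and shows a 1 in the cells
   of [A s]. *)
Definition follows (k : nat) (P : program k) (T : Type)
    (lt : T -> T -> Prop) (A : T -> nat -> 'I_k -> Prop) (N : T -> config P)
    (D : T -> Prop) (init x : config P) : Prop :=
  [/\ (forall s, ~ D s) -> x = init,
      forall s, D s -> (forall u, D u -> u = s \/ lt u s) -> x = N s
    & (exists s, D s) -> (forall s, D s -> exists u, D u /\ lt s u) ->
      x = limit_config P lt A D].

(** Position [t] stands for a stretch that starts in [C t], exits into [N t] and shows its 1s in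
    [A t]. Runs of single steps and concatenations of segments are both instances. *)
Definition chain (k : nat) (P : program k) (T : Type) (lt : T -> T -> Prop)
    (C : T -> config P) (A : T -> nat -> 'I_k -> Prop) (N : T -> config P)
    (init x : config P) : Prop :=
  (forall t, follows lt A N (lt^~ t) init (C t)) /\
  follows lt A N (fun=> True) init x.

(* The times of the run are those strictly before [x] is reached. *)
Definition open_run (k : nat) (P : program k) (T : Type)
    (lt : T -> T -> Prop) (c : T -> config P) (init x : config P) : Prop :=
  [/\ well_order lt,
      chain lt c (fun t n i => ctape (c t) n i) (fun t => step (c t)) init x
    & forall t, Defs.cst (c t) <> q_halt P].

(** The embedding [j] bounds the length of the segment from below; this later forces a simulating
    run to outlast a halting one. A time must exist so that no segment vanishes in a
    concatenation. *)
Definition segment_along (k : nat) (P : program k) (J : Type)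
    (ltJ : J -> J -> Prop) (init : config P) (A : nat -> 'I_k -> Prop)
    (x : config P) : Prop :=
  exists (T : Type) (lt : T -> T -> Prop) (c : T -> config P),
    [/\ open_run lt c init x, exists t : T, True,
        forall n i, A n i <-> exists t, ctape (c t) n i
      & exists j : J -> T, forall s t, ltJ s t -> lt (j s) (j t)].

Definition segment (k : nat) (P : program k) (init : config P)
    (A : nat -> 'I_k -> Prop) (x : config P) : Prop :=
  exists (T : Type) (lt : T -> T -> Prop) (c : T -> config P),
    [/\ open_run lt c init x, exists t : T, True
      & forall n i, A n i <-> exists t, ctape (c t) n i].

Section WellOrder.
Context (T : Type) (lt : T -> T -> Prop) (wolt : well_order lt).

Lemma wo_wf : well_founded lt. Proof. by case: wolt. Qed.

Lemma wo_trans x y z : lt x y -> lt y z -> lt x z.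
Proof. by case: wolt => _ tr _; apply: tr. Qed.

Lemma wo_total x y : [\/ lt x y, x = y | lt y x].
Proof. by case: wolt. Qed.

Lemma wo_irr x : ~ lt x x.
Proof. by elim: (wo_wf x) => {}x _ IH xx; exact: (IH x). Qed.

Lemma wo_asym x y : lt x y -> ~ lt y x.
Proof. by move=> xy yx; exact: (wo_irr (wo_trans xy yx)). Qed.

Lemma wo_min (D : T -> Prop) : (exists s, D s) ->
  exists s, D s /\ forall u, D u -> s = u \/ lt s u.
Proof.
move=> [s Ds]; apply: contrapT => nmin.
elim: (wo_wf s) Ds => {}s _ IH Ds; apply: nmin; exists s; split=> // u Du.
by case: (wo_total s u) => [|->|us]; [right|left|case: (IH u us)].
Qed.

Lemma wo_history (D : T -> Prop) :
  [\/ forall s, ~ D s,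
      exists s, D s /\ forall u, D u -> u = s \/ lt u s
    | (exists s, D s) /\ forall s, D s -> exists u, D u /\ lt s u].
Proof.
have [eD|/existsNP[s /contrapT Ds]] := pselect (forall s, ~ D s).
  by constructor 1.
have [mD|nmD] := pselect (exists s, D s /\ forall u, D u -> u = s \/ lt u s).
  by constructor 2.
constructor 3; split; first by exists s.
move=> {Ds}s Ds; apply: contrapT => nu; apply: nmD; exists s; split=> // u Du.
case: (wo_total s u) => [su|->|]; [|by left|by right].
by case: nu; exists u.
Qed.

(** If [h t] were below [t], then [h (h t)] would be below [h t], and so on; well-foundedness rules
    this out. *)
Lemma wo_mono_ge (h : T -> T) :
  (forall s t, lt s t -> lt (h s) (h t)) -> forall t, ~ lt (h t) t.
Proof.
move=> hm t; elim: (wo_wf t) => {}t _ IH ht.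
exact: (IH _ ht (hm _ _ ht)).
Qed.

Context (k : nat) (P : program k) (A : T -> nat -> 'I_k -> Prop).
Context (N : T -> config P) (D : T -> Prop) (init x : config P).

Lemma follows_first : (forall s, ~ D s) -> x = init ->
  follows lt A N D init x.
Proof. by move=> eD xi; split=> // [s /eD//|[s /eD]]. Qed.

Lemma follows_next s : D s -> (forall u, D u -> u = s \/ lt u s) -> x = N s ->
  follows lt A N D init x.
Proof.
move=> Ds smax xs; split=> [/(_ s)//|u Du umax|_ /(_ s Ds) [u [Du su]]].
  case: (smax u Du) => [->//|us].
  by case: (umax s Ds) => [<-//|/(wo_asym us)].
by case: (smax u Du) => [us|/(wo_asym su)//]; case: (@wo_irr s); rewrite -{2}us.
Qed.

Lemma follows_limit : (exists s, D s) ->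
  (forall s, D s -> exists u, D u /\ lt s u) -> x = limit_config P lt A D ->
  follows lt A N D init x.
Proof.
move=> [s Ds] nmax xl; split=> // [/(_ s)//|u Du umax].
have [v [Dv uv]] := nmax u Du.
by case: (umax v Dv) => [vu|/(wo_asym uv)//]; case: (@wo_irr u); rewrite -{2}vu.
Qed.

End WellOrder.

Lemma follows_exists (T : Type) (lt : T -> T -> Prop) (k : nat) (P : program k)
    (A : T -> nat -> 'I_k -> Prop) (N : T -> config P) (D : T -> Prop)
    (init : config P) :
  well_order lt -> exists x, follows lt A N D init x.
Proof.
move=> wolt; case: (wo_history wolt D) => [eD|[s [Ds smax]]|[De Dl]].
- by exists init; apply: follows_first.
- by exists (N s); apply: (follows_next wolt _ _ Ds smax).
- by eexists; apply: follows_limit.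
Qed.

Lemma config_tape_eq (k : nat) (P : program k) (q : state P) (h : nat)
    (t t' : nat -> 'I_k -> bool) :
  (forall n i, t n i = t' n i) -> Config q h t = Config q h t'.
Proof. by move=> tt; congr Config; apply/funext => n; apply/funext => i. Qed.

(* Only a final part of the history matters. *)
Lemma follows_tail (k : nat) (P : program k) (T T' : Type)
    (lt : T -> T -> Prop) (lt' : T' -> T' -> Prop)
    (A : T -> nat -> 'I_k -> Prop) (A' : T' -> nat -> 'I_k -> Prop)
    (N : T -> config P) (N' : T' -> config P) (D : T -> Prop) (D' : T' -> Prop)
    (g : T -> T') (init init' x : config P) :
  well_order lt -> well_order lt' ->
  (forall s u, lt s u -> lt' (g s) (g u)) ->
  (forall s, D s -> D' (g s)) ->
  (forall p, D' p -> (exists s, D s /\ p = g s) \/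
     (forall s, D s -> lt' p (g s))) ->
  (exists s, D s) ->
  (forall s, N' (g s) = N s) -> (forall s n i, A' (g s) n i <-> A s n i) ->
  follows lt A N D init x -> follows lt' A' N' D' init' x.
Proof.
move=> wolt wolt' gm gD D'g De gN gA [_ fmax flim].
have gi s u : lt' (g s) (g u) -> lt s u.
  move=> su; case: (wo_total wolt s u) => // [e|/gm us].
    by rewrite e in su; case: (wo_irr wolt' su).
  by case: (wo_asym wolt' su).
case: (wo_history wolt D) => [eD|[s [Ds smax]]|[_ Dl]].
- by case: De => s /eD.
- apply: (follows_next wolt' _ _ (gD _ Ds)); last by rewrite gN; apply: fmax.
  move=> p D'p; case: (D'g _ D'p) => [[u [Du ->]]|/(_ s Ds)]; last by right.
  by case: (smax u Du) => [->|/gm]; [left|right].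
- apply: (follows_limit wolt').
  + by case: De => s Ds; exists (g s); apply: gD.
  + move=> p D'p; case: (D'g _ D'p) => [[u [Du ->]]|pD].
      by have [v [Dv uv]] := Dl u Du; exists (g v); split; [apply: gD|apply: gm].
    by case: De => s Ds; exists (g s); split; [apply: gD|apply: pD].
  + rewrite (flim De Dl); apply: config_tape_eq => n i; apply/asboolP/asboolP.
      move=> H p D'p.
      have [s [Ds ps]] : exists s, D s /\ (p = g s \/ lt' p (g s)).
        case: (D'g _ D'p) => [[s [Ds ->]]|pD]; first by exists s; split=> //; left.
        by case: De => s Ds; exists s; split=> //; right; apply: pD.
      have [u [su [Du Au]]] := H s Ds.
      exists (g u); split; last by split; [apply: gD|apply/gA].
      case: ps su => [->|ps] [<-|/gm su]; try by [left|right].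
      by right; apply: wo_trans su.
    move=> H s Ds; have [p [sp [D'p Ap]]] := H _ (gD _ Ds).
    case: (D'g _ D'p) => [[u [Du pu]]|/(_ s Ds) ps]; last first.
      by case: sp => [e|/(wo_asym wolt' ps)//]; rewrite e in ps; case: (wo_irr wolt' ps).
    exists u; rewrite pu in sp Ap; split; last by split=> //; apply/gA.
    case: sp => [e|/gi]; last by right.
    case: (wo_total wolt s u) => [|->|/gm us]; [by right|by left|].
    by rewrite e in us; case: (wo_irr wolt' us).
Qed.

(** * Concatenation of segments *)

Section Sum.
Context (k : nat) (P : program k) (I : Type) (ltI : I -> I -> Prop).
Context (C : I -> config P) (A : I -> nat -> 'I_k -> Prop) (N : I -> config P).
Context (init x : config P).
Hypotheses (woI : well_order ltI) (chI : chain ltI C A N init x).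
Context (B : I -> Type) (ltB : forall i, B i -> B i -> Prop).
Context (c : forall i, B i -> config P).
Hypothesis runB : forall i, open_run (@ltB i) (@c i) (C i) (N i).
Hypothesis inhB : forall i, exists t : B i, True.
Hypothesis AB : forall i n j, A i n j <-> exists t : B i, ctape (c t) n j.

Local Notation lex := (lexprod I B ltI ltB).
Local Notation csum := (fun p : sigT B => c (projT2 p)).

(** The second components can only be compared along a proof that their tags are equal; for equal
    tags, proof irrelevance turns it into [erefl]. *)
Lemma lexprod_right i (b b' : B i) :
  lex (existT _ i b) (existT _ i b') -> ltB b b'.
Proof.
suff H p q : lex p q -> forall e : projT1 p = projT1 q,
    ltB (eq_rect _ B (projT2 p) _ e) (projT2 q) by move=> /H /(_ erefl).
case=> [i0 j0 ? ? ij|i0 b0 b1 bb] /= e; last by rewrite (Prop_irrelevance e erefl).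
by rewrite e in ij; case: (wo_irr woI ij).
Qed.

Lemma lexprod_tag p q : lex p q -> ltI (projT1 p) (projT1 q) \/ projT1 p = projT1 q.
Proof. by case=> [? ? ? ? ?|? ? ? ?]; [left|right]. Qed.

Lemma lexprod_wo : well_order lex.
Proof.
split.
- by apply: wf_lexprod => [|i]; [exact: wo_wf woI|case: (runB i) => /wo_wf].
- move=> p q r [i j b b' ij|i b b' bb] qr.
    case: r qr => l d qr; apply: left_lex.
    by case: (lexprod_tag qr) => /= [jl|<-//]; exact: wo_trans jl.
  case: r qr => l d qr; case: (lexprod_tag qr) => /= [|e].
    exact: left_lex.
  subst l; apply: right_lex; case: (runB i) => wo _ _.
  exact: (wo_trans wo bb (lexprod_right qr)).
- move=> [i b] [j b']; case: (wo_total woI i j) => [ij|e|ji].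
  + by constructor 1; apply: left_lex.
  + subst j; case: (runB i) => wo _ _; case: (wo_total wo b b') => [bb|->|bb].
    * by constructor 1; apply: right_lex.
    * by constructor 2.
    * by constructor 3; apply: right_lex.
  + by constructor 3; apply: left_lex.
Qed.

(** If [DI] has a last index [j], block [j] is a final part of the history and already determines
    [y]. If [DI] has no last index, a cell shows a 1 cofinally often in time iff it does so in
    cofinally many blocks, by [AB]. *)
Lemma follows_sum (DI : I -> Prop) y : follows ltI A N DI init y ->
  follows lex (fun p n i => ctape (csum p) n i) (fun p => step (csum p))
    (fun p => DI (projT1 p)) init y.
Proof.
move=> fy; case: (wo_history woI DI) => [eD|[j [Dj jmax]]|[De Dl]].
- case: fy => /(_ eD) yi _ _; apply: follows_first yi => -[i b]; exact: eD.
- have [wo [_ fx] _] := runB j.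
  have <- : N j = y by case: fy => _ /(_ j Dj jmax).
  apply: (@follows_tail _ _ _ _ (@ltB j) lex _ _ _ _ _ _ (existT B j) _ _ _
    wo lexprod_wo _ _ _ _ _ _ fx) => //.
  + by move=> s u su; apply: right_lex.
  + move=> [i b] /= Di; case: (jmax i Di) => [e|ij].
      by subst i; left; exists b.
    by right=> s _; apply: left_lex.
- apply: (follows_limit lexprod_wo).
  + by case: De => i Di; case: (inhB i) => b _; exists (existT _ i b).
  + move=> [i b] /= Di; have [j [Dj ij]] := Dl i Di.
    by case: (inhB j) => b' _; exists (existT _ j b'); split=> //; apply: left_lex.
  + case: fy => _ _ /(_ De Dl) ->; apply: config_tape_eq => n l.
    apply/asboolP/asboolP => H.
      move=> [i b] /= Di; have [j [Dj ij]] := Dl i Di.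
      have [u [ju [Du /AB[t tu]]]] := H j Dj; exists (existT _ u t).
      split=> //; right; apply: left_lex; case: ju => [<-//|].
      exact: (wo_trans woI).
    move=> i Di; case: (inhB i) => b _.
    have [[u t] [iu [/= Du tn]]] := H (existT _ i b) Di; exists u.
    split; last by split=> //; apply/AB; exists t.
    case: iu => [e|/lexprod_tag/= [|]]; [by left; case: e|by right|by left].
Qed.

Lemma open_run_sum : open_run lex csum init x.
Proof.
case: chI => chC chx; split; first exact: lexprod_wo.
  split; last exact: (@follows_sum (fun=> True)).
  move=> [i b]; have [wo [fc fe] _] := runB i.
  (* With an earlier time in its own block, the past of [b] inside the block is a final part of its
     whole past. Otherwise [b] is the first time of the block and its past consists of all earlier
     blocks. *)
  have [[b0 b0b]|bmin] := pselect (exists b', ltB b' b).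
    apply: (@follows_tail _ _ _ _ (@ltB i) lex _ _ _ _ _ _ (existT B i) _ _ _
      wo lexprod_wo _ _ _ _ _ _ (fc b)) => //.
    - by move=> s u; apply: right_lex.
    - by move=> s; apply: right_lex.
    - move=> [j b'] jb; case: (lexprod_tag jb) => /= [ji|e].
        by right=> s _; apply: left_lex.
      by subst j; left; exists b'; split=> //; apply: lexprod_right.
    - by exists b0.
  have -> : (fun q => lex q (existT B i b)) = (fun q => ltI (projT1 q) i).
    apply/funext => -[j b']; apply/propext; split=> /= [jb|]; last exact: left_lex.
    case: (lexprod_tag jb) => //= e; subst j; case: bmin; exists b'.
    exact: lexprod_right.
  apply: (@follows_sum (ltI^~ i)).
  have -> : c (projT2 (existT B i b)) = C i by case: (fc b) => -> // s sb; apply: bmin; exists s.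
  exact: chC.
by move=> [i b] /=; case: (runB i).
Qed.

End Sum.

Lemma segment_sum (k : nat) (P : program k) (I : Type) (ltI : I -> I -> Prop)
    (C : I -> config P) (A : I -> nat -> 'I_k -> Prop) (N : I -> config P)
    (init x : config P) :
  well_order ltI -> chain ltI C A N init x ->
  (forall i, segment (C i) (A i) (N i)) -> (exists i : I, True) ->
  segment_along ltI init (fun n j => exists i, A i n j) x.
Proof.
move=> woI chI segI [i0 _].
have /choice[f Hf] : forall i, exists B : {T : Type & ((T -> T -> Prop) * (T -> config P))%type},
    [/\ open_run (projT2 B).1 (projT2 B).2 (C i) (N i), exists t : projT1 B, True
      & forall n j, A i n j <-> exists t, ctape ((projT2 B).2 t) n j].
  by move=> i; case: (segI i) => T [lt [c H]]; exists (existT _ T (lt, c)).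
have runB i := let: And3 r _ _ := Hf i in r.
have inhB i := let: And3 _ r _ := Hf i in r.
have AB i := let: And3 _ _ r := Hf i in r.
exists {i : I & projT1 (f i)},
  (lexprod I (fun i => projT1 (f i)) ltI (fun i => (projT2 (f i)).1)),
  (fun p => (projT2 (f (projT1 p))).2 (projT2 p)); split.
- exact: (open_run_sum (c := fun i => (projT2 (f i)).2) woI chI runB inhB AB).
- by case: (inhB i0) => t _; exists (existT _ i0 t).
- move=> n j; split=> [[i /AB[t tn]]|[[i t] tn]]; first by exists (existT _ i t).
  by exists i; apply/AB; exists t.
- by exists (fun i => existT _ i (projT1 (cid (inhB i)))) => s t; exact: left_lex.
Qed.

Lemma segment_alongW (k : nat) (P : program k) (J : Type)
    (ltJ : J -> J -> Prop) (init : config P) A x :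
  segment_along ltJ init A x -> segment init A x.
Proof. by move=> [T [lt [c [r i a _]]]]; exists T, lt, c. Qed.

(** * Existence and comparison of runs *)

Definition is_run (k : nat) (P : program k) (T : Type) (lt : T -> T -> Prop)
    (c : T -> config P) (init : config P) : Prop :=
  forall t, follows lt (fun t n i => ctape (c t) n i) (fun t => step (c t))
              (lt^~ t) init (c t).

Lemma follows_uniq (k : nat) (P : program k) (T : Type) (lt : T -> T -> Prop)
    (A : T -> nat -> 'I_k -> Prop) (N : T -> config P) (D : T -> Prop)
    (init x y : config P) : well_order lt ->
  follows lt A N D init x -> follows lt A N D init y -> x = y.
Proof.
move=> wolt [x1 x2 x3] [y1 y2 y3].
case: (wo_history wolt D) => [eD|[s [Ds smax]]|[De Dl]].
- by rewrite x1 // y1.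
- by rewrite (x2 s) // (y2 s).
- by rewrite x3 // y3.
Qed.

Lemma follows_ext (k : nat) (P : program k) (T : Type) (lt : T -> T -> Prop)
    (A A' : T -> nat -> 'I_k -> Prop) (N N' : T -> config P) (D : T -> Prop)
    (init x : config P) : well_order lt ->
  (forall s, D s -> A s = A' s) -> (forall s, D s -> N s = N' s) ->
  follows lt A N D init x -> follows lt A' N' D init x.
Proof.
move=> wolt AA NN [x1 x2 x3]; split=> // [s Ds smax|De Dl].
  by rewrite -NN //; apply: x2.
rewrite x3 //; apply: config_tape_eq => n i; apply/asboolP/asboolP => H s Ds.
  by have [u [su [Du Au]]] := H s Ds; exists u; rewrite -AA.
by have [u [su [Du Au]]] := H s Ds; exists u; rewrite AA.
Qed.

Lemma follows_image (k : nat) (P : program k) (T T' : Type)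
    (lt : T -> T -> Prop) (lt' : T' -> T' -> Prop)
    (A : T -> nat -> 'I_k -> Prop) (A' : T' -> nat -> 'I_k -> Prop)
    (N : T -> config P) (N' : T' -> config P) (D : T -> Prop) (D' : T' -> Prop)
    (g : T -> T') (init x : config P) :
  well_order lt -> well_order lt' ->
  (forall s u, lt s u -> lt' (g s) (g u)) ->
  (forall p, D' p <-> exists s, D s /\ p = g s) ->
  (forall s, N' (g s) = N s) -> (forall s n i, A' (g s) n i <-> A s n i) ->
  follows lt A N D init x <-> follows lt' A' N' D' init x.
Proof.
move=> wolt wolt' gm D'E gN gA.
have imp y : follows lt A N D init y -> follows lt' A' N' D' init y.
  move=> fy; have [De|/forallNP eD] := pselect (exists s, D s); last first.
    case: fy => y1 _ _; apply: follows_first; last exact: y1.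
    by move=> p /D'E[s [/eD]].
  apply: (@follows_tail _ _ _ _ lt lt' _ _ _ _ _ _ g _ _ _
    wolt wolt' _ _ _ _ _ _ fy) => //.
    by move=> s Ds; apply/D'E; exists s.
  by move=> p /D'E; left.
split; first exact: imp.
move=> fx; have [y fy] := follows_exists A N D init wolt.
by rewrite (follows_uniq wolt' fx (imp _ fy)).
Qed.

Lemma wo_sub (T : Type) (lt : T -> T -> Prop) (D : T -> Prop) :
  well_order lt -> well_order (fun s t : {x | D x} => lt (sval s) (sval t)).
Proof.
move=> wolt; split.
- move=> [s Ds]; elim: (wo_wf wolt s) Ds => {}s _ IH Ds.
  by constructor=> -[u Du] /= /IH.
- by move=> [x ?] [y ?] [z ?] /=; apply: wo_trans.
- move=> [x Dx] [y Dy] /=; case: (wo_total wolt x y) => [|e|].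
  + by constructor 1.
  + by subst y; rewrite (Prop_irrelevance Dx Dy); constructor 2.
  + by constructor 3.
Qed.

Lemma open_run_before (k : nat) (P : program k) (T : Type)
    (lt : T -> T -> Prop) (c : T -> config P) (init : config P) (t : T) :
  well_order lt -> is_run lt c init ->
  (forall s, lt s t -> Defs.cst (c s) <> q_halt P) ->
  open_run (fun s u : {x | lt x t} => lt (sval s) (sval u))
    (fun s => c (sval s)) init (c t).
Proof.
move=> wolt rc nh; have wos := wo_sub (lt^~ t) wolt.
split=> [//||[s st]]; last exact: nh.
split=> [[u ut]|].
  apply/(@follows_image _ _ _ _ _ lt _ (fun t n i => ctape (c t) n i) _
    (fun t => step (c t)) _ (lt^~ u) sval) => //= p.
  split=> [pu|[s [su ->]]//].
  by exists (exist _ p (wo_trans wolt pu ut)).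
apply/(@follows_image _ _ _ _ _ lt _ (fun t n i => ctape (c t) n i) _
  (fun t => step (c t)) _ (lt^~ t) sval) => //= p.
by split=> [pt|[[s st] [_ ->]]//]; exists (exist _ p pt).
Qed.

Definition add_top (T : Type) (lt : T -> T -> Prop) (s t : option T) : Prop :=
  match s, t with
  | Some s, Some t => lt s t
  | Some _, None => True
  | None, _ => False
  end.

Lemma wo_add_top (T : Type) (lt : T -> T -> Prop) :
  well_order lt -> well_order (add_top lt).
Proof.
move=> wolt; have wfS s : Acc (add_top lt) (Some s).
  elim: (wo_wf wolt s) => {}s _ IH; constructor=> -[u us|[]]; exact: IH.
split.
- move=> [s|]; first exact: wfS.
  constructor=> -[u _|[]]; exact: wfS.
- by move=> [x|] [y|] [z|] //=; apply: wo_trans.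
- move=> [x|] [y|] /=; [|by constructor 1|by constructor 3|by constructor 2].
  by case: (wo_total wolt x y) => [|->|]; [constructor 1|constructor 2|constructor 3].
Qed.

(** The bottom [None] is the position of the setup segment that precedes a simulation. *)
Definition add_bot (T : Type) (lt : T -> T -> Prop) (s t : option T) : Prop :=
  match s, t with
  | Some s, Some t => lt s t
  | None, Some _ => True
  | _, None => False
  end.

Lemma wo_add_bot (T : Type) (lt : T -> T -> Prop) :
  well_order lt -> well_order (add_bot lt).
Proof.
move=> wolt; have wfN : Acc (add_bot lt) None by constructor=> -[? []|[]].
split.
- move=> [s|]; last exact: wfN.
  elim: (wo_wf wolt s) => {}s _ IH.
  constructor=> -[u us|_]; [exact: IH|exact: wfN].
- by move=> [x|] [y|] [z|] //=; apply: wo_trans.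
- move=> [x|] [y|] /=; [|by constructor 3|by constructor 1|by constructor 2].
  by case: (wo_total wolt x y) => [|->|]; [constructor 1|constructor 2|constructor 3].
Qed.

Definition halting_at (k : nat) (P : program k) (T : Type)
    (lt : T -> T -> Prop) (c : T -> config P) (tend : T) (init : config P) :
    Prop :=
  [/\ well_order lt, forall t, t = tend \/ lt t tend, is_run lt c init,
      forall t, lt t tend -> Defs.cst (c t) <> q_halt P
    & Defs.cst (c tend) = q_halt P].

Lemma halting_runE (k : nat) (P : program k) (init fin : config P) :
  halting_run init fin <->
  exists (T : Type) (lt : T -> T -> Prop) (c : T -> config P) (tend : T),
    halting_at lt c tend init /\ c tend = fin.
Proof.
split.
  move=> [T [lt [c [tend [wf [tr [to [top [r0 [r1 [r2 [nh [h e]]]]]]]]]]]]].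
  exists T, lt, c, tend; split=> //; split=> // t; split=> [/r0//|s st smax|].
    apply: r1 => // u [su ut]; case: (smax u ut) => [us|us].
      by case: (@wo_irr _ lt (And3 wf tr to) s); rewrite -{2}us.
    by case: (@wo_asym _ lt (And3 wf tr to) _ _ su).
  move=> De Dl; apply: r2 => // s /Dl [u [ut su]]; by exists u.
move=> [T [lt [c [tend [[[wf tr to] top r nh h] e]]]]].
exists T, lt, c, tend; do 4!split=> //; split; last split; last split => //.
- by move=> t; case: (r t).
- move=> s t st nb; case: (r t) => _ r1 _; apply: r1 => // u ut.
  case: (to u s) => [|->|su]; [by right|by left|].
  by case: (nb u).
- move=> t De Dl; case: (r t) => _ _; apply=> // s /Dl [u [su ut]]; by exists u.
Qed.

(** Cutting off the last time of a halting run leaves an open run; conversely [fin] is appended as a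
    new last time. *)
Lemma halting_runP (k : nat) (P : program k) (init fin : config P) :
  halting_run init fin <-> Defs.cst fin = q_halt P /\
  exists (T : Type) (lt : T -> T -> Prop) (c : T -> config P),
    open_run lt c init fin.
Proof.
split.
  move=> /halting_runE[T [lt [c [tend [[wolt top r nh h] <-]]]]]; split=> //.
  by do 3!eexists; apply: open_run_before r nh.
move=> [h [T [lt [c [wolt [r e] nh]]]]]; apply/halting_runE.
exists (option T), (add_top lt), (fun o => if o is Some t then c t else fin), None.
have wot := wo_add_top wolt.
split=> //; split=> //.
- by move=> [t|]; [right|left].
- move=> [t|].
    apply/(@follows_image _ _ _ _ lt _ (fun t n i => ctape (c t) n i) _
      (fun t => step (c t)) _ (lt^~ t) _ Some) => //= -[s|] /=.
      by split=> [st|[u [us [->]]]//]; exists s.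
    by split=> // -[u []].
  apply/(@follows_image _ _ _ _ lt _ (fun t n i => ctape (c t) n i) _
    (fun t => step (c t)) _ (fun=> True) _ Some) => //= -[s|] /=.
    by split=> // _; exists s.
  by split=> // -[u []].
- by move=> [t|] //= _; apply: nh.
Qed.

Lemma halts_of_halting_time (k : nat) (P : program k) (T : Type)
    (lt : T -> T -> Prop) (c : T -> config P) (init : config P) (t : T) :
  well_order lt -> is_run lt c init -> Defs.cst (c t) = q_halt P ->
  exists fin : config P, halting_run init fin.
Proof.
move=> wolt r h.
have [s [hs smin]] := wo_min wolt (ex_intro (fun t => Defs.cst (c t) = q_halt P) t h).
exists (c s); apply/halting_runP; split=> //; do 3!eexists.
apply: open_run_before r _ => // u us hu.
by case: (smin u hu) => [e|/(wo_asym wolt us)//]; rewrite e in us; case: (wo_irr wolt us).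
Qed.

Lemma run_exists (k : nat) (P : program k) (T : Type) (lt : T -> T -> Prop)
    (init : config P) : well_order lt -> exists c, is_run lt c init.
Proof.
move=> wolt.
(* The recursion supplies configurations only below [t]; [init] is a filler elsewhere, and
   [follows_ext] removes it afterwards. *)
pose ext t (r : forall s, lt s t -> config P) s :=
  if pselect (lt s t) is left h then r s h else init.
pose F t (r : forall s, lt s t -> config P) : config P :=
  projT1 (cid (follows_exists (fun s n i => ctape (ext t r s) n i)
                 (fun s => step (ext t r s)) (lt^~ t) init wolt)).
pose c := Fix (wo_wf wolt) (fun=> config P) F; exists c => t.
have -> : c t = F t (fun s _ => c s).
  apply: Fix_eq => u f g fg; congr (F u _).
  by apply: functional_extensionality_dep => s; apply/funext.
have eE s : lt s t -> ext t (fun s _ => c s) s = c s.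
  by rewrite /ext; case: pselect.
rewrite /F; case: cid => y /=; apply: follows_ext => // s /eE -> //.
Qed.

Section Compare.
Context (T1 T2 : Type) (lt1 : T1 -> T1 -> Prop) (lt2 : T2 -> T2 -> Prop).
Hypotheses (wo1 : well_order lt1) (wo2 : well_order lt2).

(** Times whose pasts have the same order type, matched back and forth; this compares ordinals
    without naming them. *)
Inductive same_time : T1 -> T2 -> Prop :=
  SameTime t1 t2 :
    (forall s1, lt1 s1 t1 -> exists2 s2, lt2 s2 t2 & same_time s1 s2) ->
    (forall s2, lt2 s2 t2 -> exists2 s1, lt1 s1 t1 & same_time s1 s2) ->
    same_time t1 t2.

Lemma same_time_l t1 t2 s1 : same_time t1 t2 -> lt1 s1 t1 ->
  exists2 s2, lt2 s2 t2 & same_time s1 s2.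
Proof. by case=> {}t1 {}t2 H _; apply: H. Qed.

Lemma same_time_r t1 t2 s2 : same_time t1 t2 -> lt2 s2 t2 ->
  exists2 s1, lt1 s1 t1 & same_time s1 s2.
Proof. by case=> {}t1 {}t2 _ H; apply: H. Qed.

Lemma same_time_fun t1 t2 t2' : same_time t1 t2 -> same_time t1 t2' -> t2 = t2'.
Proof.
elim: (wo_wf wo1 t1) t2 t2' => {}t1 _ IH.
suff H t2 t2' : same_time t1 t2 -> same_time t1 t2' -> ~ lt2 t2 t2'.
  move=> t2 t2' e e'; case: (wo_total wo2 t2 t2') => // l.
    by case: (H _ _ e e').
  by case: (H _ _ e' e).
move=> e e' l; have [s1 s1t e1] := same_time_r e' l.
have [s2 s2t e2] := same_time_l e s1t.
by rewrite (IH _ s1t _ _ e1 e2) in s2t; exact: (wo_irr wo2 s2t).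
Qed.

Lemma same_time_mono s1 s2 t1 t2 : same_time s1 s2 -> same_time t1 t2 ->
  lt1 s1 t1 -> lt2 s2 t2.
Proof.
move=> es et st; have [u2 u2t eu] := same_time_l et st.
by rewrite (same_time_fun es eu).
Qed.

Lemma same_time_inj t1 t1' t2 : same_time t1 t2 -> same_time t1' t2 -> t1 = t1'.
Proof.
move=> e e'; case: (wo_total wo1 t1 t1') => // l.
  by case: (wo_irr wo2 (same_time_mono e e' l)).
by case: (wo_irr wo2 (same_time_mono e' e l)).
Qed.

Lemma same_time_mono_inv s1 s2 t1 t2 : same_time s1 s2 -> same_time t1 t2 ->
  lt2 s2 t2 -> lt1 s1 t1.
Proof.
move=> es et st; have [u1 u1t eu] := same_time_r et st.
by rewrite (same_time_inj es eu).
Qed.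

(** Comparability of well-orders: the least unmatched times of the two sides would have their pasts
    matched with each other, and would thus be matched. *)
Lemma same_time_total :
  (forall t1, exists t2, same_time t1 t2) \/ (forall t2, exists t1, same_time t1 t2).
Proof.
apply: contrapT => /not_orP[/existsNP/(wo_min wo1)[t1 [n1 m1]]].
move=> /existsNP/(wo_min wo2)[t2 [n2 m2]].
apply: (n1); exists t2; constructor.
- move=> s1 st; apply: contrapT => ne.
  have [s2 e] : exists s2, same_time s1 s2.
    apply: contrapT => /m1[e|/(wo_asym wo1 st)//].
    by rewrite e in st; case: (wo_irr wo1 st).
  case: (wo_total wo2 s2 t2) => [l|e'|l].
  + by apply: ne; exists s2.
  + by apply: n2; exists s1; rewrite -e'.
  + by have [u1 _ eu] := same_time_r e l; apply: n2; exists u1.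
- move=> s2 st; apply: contrapT => ne.
  have [s1 e] : exists s1, same_time s1 s2.
    apply: contrapT => /m2[e|/(wo_asym wo2 st)//].
    by rewrite e in st; case: (wo_irr wo2 st).
  case: (wo_total wo1 s1 t1) => [l|e'|l].
  + by apply: ne; exists s1.
  + by apply: n1; exists s2; rewrite -e'.
  + by have [u2 _ eu] := same_time_l e l; apply: n1; exists u2.
Qed.

Context (k : nat) (P : program k) (c1 : T1 -> config P) (c2 : T2 -> config P).
Context (init : config P).
Hypotheses (r1 : is_run lt1 c1 init) (r2 : is_run lt2 c2 init).

(** Machines are deterministic: by induction, a configuration depends only on the order type of its
    past. *)
Lemma same_time_config t1 t2 : same_time t1 t2 -> c1 t1 = c2 t2.
Proof.
elim: (wo_wf wo1 t1) t2 => {}t1 _ IH t2 e.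
have [a1 a2 a3] := r1 t1; have [b1 b2 b3] := r2 t2.
case: (wo_history wo1 (lt1^~ t1)) => [eD|[s [Ds smax]]|[De Dl]].
- by rewrite a1 // b1 // => s2 /(same_time_r e)[s1 /eD].
- have [s2 s2t es] := same_time_l e Ds.
  rewrite (a2 s Ds smax) (IH _ Ds _ es); apply/esym/b2 => // u2 u2t.
  have [u1 u1t eu] := same_time_r e u2t.
  case: (smax u1 u1t) => [us|us].
    by left; rewrite us in eu; exact: same_time_fun eu es.
  by right; apply: same_time_mono eu es us.
- rewrite a3 // b3 //; last 2 first.
  + by case: De => s1 /(same_time_l e)[s2 s2t _]; exists s2.
  + move=> s2 s2t; have [s1 s1t es] := same_time_r e s2t.
    have [u1 [u1t su]] := Dl _ s1t; have [u2 u2t eu] := same_time_l e u1t.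
    by exists u2; split=> //; apply: same_time_mono es eu su.
  + apply: config_tape_eq => n i; apply/asboolP/asboolP => H.
      move=> s2 s2t; have [s1 s1t es] := same_time_r e s2t.
      have [u1 [su [u1t h]]] := H _ s1t; have [u2 u2t eu] := same_time_l e u1t.
      exists u2; rewrite -(IH _ u1t _ eu); split=> //.
      case: su => [su|su]; last by right; apply: same_time_mono es eu su.
      by left; rewrite -su in eu; exact: same_time_fun es eu.
    move=> s1 s1t; have [s2 s2t es] := same_time_l e s1t.
    have [u2 [su [u2t h]]] := H _ s2t; have [u1 u1t eu] := same_time_r e u2t.
    exists u1; rewrite (IH _ u1t _ eu); split=> //.
    case: su => [su|su]; last by right; apply: same_time_mono_inv es eu su.
    by left; rewrite -su in eu; exact: same_time_inj es eu.
Qed.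

(** If [tend] has a counterpart, the second run halts there. Otherwise every time of the second run
    has a counterpart below [tend], and [j] followed by this matching is a monotone self-map of [T1]
    sending [tend] below itself. *)
Lemma halting_at_not_longer (tend : T1) (j : T1 -> T2) :
  halting_at lt1 c1 tend init -> (forall t, Defs.cst (c2 t) <> q_halt P) ->
  ~ (forall s t, lt1 s t -> lt2 (j s) (j t)).
Proof.
move=> [_ top _ _ h] nh jm.
case: same_time_total => [/(_ tend)[t2 /same_time_config e]|/choice[g gE]].
  by apply: (nh t2); rewrite -e.
have gne t : lt1 (g t) tend.
  case: (top (g t)) => // e; case: (nh t); rewrite -h -e.
  by rewrite (same_time_config (gE t)).
apply: (wo_mono_ge wo1 (h := fun t => g (j t)) _ (gne (j tend))) => s t /jm.
exact: same_time_mono_inv.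
Qed.

Lemma halting_at_uniq (e1 : T1) (e2 : T2) :
  halting_at lt1 c1 e1 init -> halting_at lt2 c2 e2 init -> c1 e1 = c2 e2.
Proof.
move=> [_ top1 _ n1 h1] [_ top2 _ n2 h2].
case: same_time_total => [/(_ e1)[t2 /same_time_config e]|/(_ e2)[t1 /same_time_config e]].
  case: (top2 t2) => [<-//|/n2]; by rewrite -e.
case: (top1 t1) => [<-//|/n1]; by rewrite e.
Qed.

End Compare.

Lemma halting_run_uniq (k : nat) (P : program k) (init fin fin' : config P) :
  halting_run init fin -> halting_run init fin' -> fin = fin'.
Proof.
move=> /halting_runE[T1 [lt1 [c1 [e1 [h1 <-]]]]].
move=> /halting_runE[T2 [lt2 [c2 [e2 [h2 <-]]]]].
by have [? _ ? _ _] := h1; have [? _ ? _ _] := h2; apply: halting_at_uniq h1 h2.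
Qed.

(** * Finite and omega segments, simulation *)

Section Segments.
Context (k : nat) (P : program k).
Implicit Types (c init x : config P) (A S : nat -> 'I_k -> Prop).

Local Notation running c := (Defs.cst c <> q_halt P).

Lemma segment_halting init A x :
  segment init A x -> Defs.cst x = q_halt P -> halting_run init x.
Proof.
by move=> [T [lt [c [r _ _]]]] h; apply/halting_runP; split=> //; exists T, lt, c.
Qed.

Lemma segment_step c : running c -> segment c (fun n i => ctape c n i) (step c).
Proof.
move=> rc; exists unit, (fun _ _ => False), (fun=> c).
have wou : well_order (fun _ _ : unit => False).
  by split=> [[]|//|[] []]; [constructor|constructor 2].
split; [split=> //|by exists tt|by move=> n i; split=> [|[]//]; exists tt].
split=> [t|]; first by split=> // -[].
by apply: (follows_next wou _ _ (s := tt)) => // -[]; left.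
Qed.

Lemma segment_cat init A x B y : segment init A x -> segment x B y ->
  segment init (fun n i => A n i \/ B n i) y.
Proof.
move=> s1 s2; pose ltb (a b : bool) : Prop := ~~ a && b.
have wob : well_order ltb.
  split=> [|[] [] [] //|[] []]; last 4 first.
  - by constructor 2.
  - by constructor 3.
  - by constructor 1.
  - by constructor 2.
  have acc0 : Acc ltb false by constructor=> -[h|h]; discriminate h.
  case; last exact: acc0.
  by constructor=> -[h|_]; [discriminate h|exact: acc0].
have H : segment_along ltb init (fun n i => exists b : bool, (if b then B else A) n i) y.
  apply: (@segment_sum _ _ _ ltb (fun b => if b then x else init) _
    (fun b => if b then y else x)) => //; last 2 first.
  - by case.
  - by exists true.
  split=> [[]|].
  + apply: (follows_next wob _ _ (s := false)) => // -[] //; by left.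
  + by apply: follows_first => // -[].
  + by apply: (follows_next wob _ _ (s := true)) => // -[]; [left|right].
have := segment_alongW H; congr (segment _ _ _); apply/funext => n; apply/funext => i.
apply/propext; split=> [[[]]|[]]; [by right|by left|by exists false|by exists true].
Qed.

Lemma wo_ltn : well_order (fun m n : nat => m < n : Prop).
Proof.
split=> [n|m n p|m n].
- by elim/ltn_ind: n => n IH; constructor.
- exact: ltn_trans.
- by case: (ltngtP m n) => [||->]; [constructor 1|constructor 3|constructor 2].
Qed.

(** The limit tape is read off from what the segments show: a cell that is 1 at some moment of every
    late segment is 1 at the limit, even if it is 0 at the ends of all of them. The flag of the
    setup relies on this. *)
Lemma segment_omega (C : nat -> config P) (A : nat -> nat -> 'I_k -> Prop)
    (t : nat -> 'I_k -> bool) :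
  (forall n, segment (C n) (A n) (C n.+1)) ->
  (forall p i, exists K, forall n, K <= n -> (A n p i <-> t p i)) ->
  segment (C 0) (fun p i => exists n, A n p i) (Config (q_limit P) 0 t).
Proof.
move=> CA At; apply: (@segment_alongW _ _ _ (fun m n : nat => m < n : Prop)).
apply: segment_sum CA _; [exact: wo_ltn| |by exists 0].
split=> [[|n]|]; first by apply: follows_first.
  apply: (follows_next wo_ltn _ _ (s := n)) => // u.
  by rewrite ltnS leq_eqVlt => /orP[/eqP|]; [left|right].
apply: (follows_limit wo_ltn); first by exists 0.
  by move=> s _; exists s.+1; split=> //=.
apply: config_tape_eq => p i; have [K KA] := At p i.
apply/idP/asboolP => [tp s _|/(_ K I)[u [Ku [_ /KA]]]].
  exists (maxn s K); split; last by split=> //; apply/KA => //; exact: leq_maxr.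
  by case: (ltnP s K) => sK; [right|left]; rewrite /=; lia.
by apply; case: Ku => [<-|/ltnW].
Qed.

(** [S] bounds the 1s shown before the last configuration, which belongs to the next stretch. Only
    an upper bound is tracked; lower bounds come from the tape at the start of a segment. *)
Definition reach S c c' : Prop := exists n, c' = iter n (@step k P) c /\
  forall m, m < n -> running (iter m (@step k P) c) /\
    forall p i, ctape (iter m (@step k P) c) p i -> S p i.

Lemma reach_refl S c : reach S c c.
Proof. by exists 0. Qed.

Lemma reach_trans S c1 c2 c3 : reach S c1 c2 -> reach S c2 c3 -> reach S c1 c3.
Proof.
move=> [m [-> mS]] [n [-> nS]]; exists (n + m); split; first by rewrite iterD.
move=> l ln; case: (ltnP l m) => lm; first exact: mS.
by rewrite -(subnK lm) iterD; apply: nS; lia.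
Qed.

Lemma reach_step S c c' : running c -> (forall p i, ctape c p i -> S p i) ->
  reach S (step c) c' -> reach S c c'.
Proof.
move=> rc cS; apply: reach_trans; exists 1; split=> //.
by case=> // _; split.
Qed.

Lemma reach_segment S c c' : running c -> (forall p i, ctape c p i -> S p i) ->
  reach S (step c) c' ->
  exists A, [/\ segment c A c', forall p i, ctape c p i -> A p i
             & forall p i, A p i -> S p i].
Proof.
move=> rc cS [n [-> nS]]; elim: n c rc cS nS => [|n IH] c rc cS nS.
  exists (fun n i => ctape c n i); split=> //; exact: segment_step.
have [r1 S1] := nS 0 isT.
have [m mn|A [sA cA AS]] := IH (step c) r1 S1.
  by have := nS m.+1 mn; rewrite iterSr.
exists (fun p i => ctape c p i \/ A p i); split.
- by rewrite iterSr; apply: segment_cat (segment_step rc) sA.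
- by move=> p i; left.
- by move=> p i [/cS|/AS].
Qed.

(** A segment has at least one time, and different ends exclude a computation of zero steps. *)
Lemma reach_neq_segment S c c' : reach S c c' -> c <> c' ->
  exists A, [/\ segment c A c', forall p i, ctape c p i -> A p i
             & forall p i, A p i -> S p i].
Proof.
move=> [[|n] [-> nS]] // _; have [rc cS] := nS 0 isT.
apply: reach_segment => //; exists n; split; first by rewrite iterSr.
by move=> l ln; have := nS l.+1 ln; rewrite iterSr.
Qed.

(** After finitely many steps the machine runs on through the configurations [D n], whose cells
    become constant one by one; the limit shows the eventual values. *)
Lemma reach_omega_segment S c (D : nat -> config P) (t : nat -> 'I_k -> bool) :
  reach S c (D 0) -> (forall n, D n.+1 = step (D n)) ->
  (forall n, running (D n)) -> (forall n p i, ctape (D n) p i -> S p i) ->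
  (forall p i, exists K, forall n, K <= n -> ctape (D n) p i = t p i) ->
  exists A, [/\ segment c A (Config (q_limit P) 0 t),
                forall p i, ctape c p i -> A p i & forall p i, A p i -> S p i].
Proof.
move=> [n0 [D0 H0]] DS Dr DSub Dt.
have Diter n : iter (n + n0) (@step k P) c = D n.
  by elim: n => [|n IH]; rewrite ?D0 // addSn iterS IH DS.
have Hi n : running (iter n (@step k P) c) /\
    forall p i, ctape (iter n (@step k P) c) p i -> S p i.
  case: (ltnP n n0) => [/H0//|nn0]; rewrite -(subnK nn0) Diter; split=> //.
  exact: DSub.
exists (fun p i => exists n, ctape (iter n (@step k P) c) p i); split.
- apply: (segment_omega (C := fun n => iter n (@step k P) c)
    (A := fun n p i => ctape (iter n (@step k P) c) p i)) => [n|p i].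
    by rewrite iterS; apply: segment_step; case: (Hi n).
  have [K KE] := Dt p i; exists (K + n0) => n nK.
  have n0n : n0 <= n by lia.
  by rewrite -(subnK n0n) Diter KE //; lia.
- by move=> p i cp; exists 0.
- by move=> p i [n]; case: (Hi n) => _; apply.
Qed.

End Segments.

(* A cell of the simulating machine either is constant or copies a cell of the
   simulated one, so that encoding commutes with the limsup. *)
Definition encode (k k' : nat) (e : nat -> 'I_k' -> bool + nat * 'I_k)
    (t : nat -> 'I_k -> bool) (p : nat) (i : 'I_k') : bool :=
  match e p i with inl b => b | inr nj => t nj.1 nj.2 end.

Section Simulation.
Context (k k' : nat) (P : program k) (P' : program k').
Context (e : nat -> 'I_k' -> bool + nat * 'I_k).
Context (sim_state : state P -> state P') (sim_head : nat -> nat).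

Local Notation enc := (encode e).

Definition sim_config (c : config P) : config P' :=
  Config (sim_state (Defs.cst c)) (sim_head (chead c)) (enc (ctape c)).

Definition sim_limit (t : nat -> 'I_k -> bool) : config P' :=
  Config (q_limit P') 0 (enc t).

(** The lower bound keeps the simulated 1s visible; the upper bound forbids a 1 that neither the old
    nor the new tape has. Together they make the limsups of both machines agree. *)
Definition sim_bounds (A : nat -> 'I_k' -> Prop) (c : config P) : Prop :=
  (forall p i, enc (ctape c) p i -> A p i) /\
  (forall p i, A p i -> enc (ctape c) p i \/ enc (ctape (step c)) p i).

(** After a step the simulating machine already holds the image of [c]; after a limit it is in its
    own limit state on cell 0, sees the encoded tape and still has to find its way to that image. *)
Definition sim_entry (c : config P) (c' : config P') : Prop :=
  c' = sim_config c \/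
  exists t, c = Config (q_limit P) 0 t /\ c' = sim_limit t.

Hypothesis sim_block : forall c c', Defs.cst c <> q_halt P -> sim_entry c c' ->
  exists A, segment c' A (sim_config (step c)) /\ sim_bounds A c.

Section Along.
Context (T : Type) (lt : T -> T -> Prop) (c : T -> config P).
Context (init x : config P) (init' : config P') (A0 : nat -> 'I_k' -> Prop).
Hypothesis crun : open_run lt c init x.
Hypothesis setup : segment init' A0 (sim_config init).

Local Notation entry D y := (if `[< (exists s, D s) /\
    (forall s, D s -> exists u, D u /\ lt s u) >]
  then sim_limit (ctape y) else sim_config y).

Lemma entry_sim (D : T -> Prop) y :
  follows lt (fun t n i => ctape (c t) n i) (fun t => step (c t)) D init y ->
  sim_entry y (entry D y).
Proof.
move=> [_ _ fl]; case: asboolP => [[De Dl]|_]; last by left.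
by right; exists (ctape y); split=> //; rewrite (fl De Dl).
Qed.

Context (A : T -> nat -> 'I_k' -> Prop).
Hypothesis Abounds : forall t, sim_bounds (A t) (c t).

Let AO (o : option T) := if o is Some t then A t else A0.
Let NO (o : option T) :=
  sim_config (if o is Some t then step (c t) else init).

(** Limsups are compared cell by cell. A constant cell shows its value in every block; for a copied
    cell the two bounds of [sim_bounds] translate occurrences of a 1 in both directions. *)
Lemma follows_entry (D : T -> Prop) y :
  (forall s t, lt s t -> D t -> D s) ->
  follows lt (fun t n i => ctape (c t) n i) (fun t => step (c t)) D init y ->
  follows (add_bot lt) AO NO (fun o => if o is Some s then D s else True)
    init' (entry D y).
Proof.
move=> Dd fy; have [wolt [rc _] _] := crun; have wob := wo_add_bot wolt.
case: asboolP => [[De Dl]|nl].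
  apply: (follows_limit wob).
  - by exists None.
  - move=> [s Ds|_]; first by have [u [Du su]] := Dl s Ds; exists (Some u).
    by case: De => s Ds; exists (Some s).
  - case: (fy) => _ _ ->//; apply: config_tape_eq => p i.
    rewrite /encode; case ep: (e p i) => [b|[n j]] /=.
      have Ab s : A s p i <-> b.
        have [lo up] := Abounds s; move: (lo p i) (up p i).
        by rewrite /encode ep => l u; split=> [/u[]|].
      apply/idP/asboolP => [hb o Do|].
        case: De => s Ds; case: o Do => [u Du|_].
          by exists (Some u); split; [left|split=> //; apply/Ab].
        by exists (Some s); split; [right|split=> //; apply/Ab].
      case: De => s Ds /(_ (Some s) Ds) [[u|] [su [Du]]]; first by move/Ab.
      by case: su.
    have lo s : ctape (c s) n j -> A s p i.
      by move=> h; case: (Abounds s) => + _; apply; rewrite /encode ep.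
    have up s : A s p i -> ctape (c s) n j \/ ctape (step (c s)) n j.
      by move=> h; case: (Abounds s) => _ /(_ p i h); rewrite /encode ep.
    apply/asboolP/asboolP => [H [s|] Ds|H s Ds].
    + have [u [su [Du Hu]]] := H s Ds; exists (Some u); split.
        by case: su => [->|]; [left|right].
      by split=> //; apply: lo.
    + case: De => s {}Ds; have [u [su [Du Hu]]] := H s Ds; exists (Some u).
      by split; [right|split=> //; apply: lo].
    + have [[u|] [su [Du Hu]]] := H (Some s) Ds; last by case: su.
      have su' : s = u \/ lt s u by case: su => [[]|]; [left|right].
      case: (up u Hu) => hu; first by exists u.
      (* A 1 that block [u] shows only because of the new tape is a 1 of the successor [v] of [u],
         which is still in [D] since [D] has no last element. *)
      have [w [Dw uw]] := Dl u Du.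
      have [v [uv vmin]] := wo_min wolt (ex_intro (lt u) w uw).
      have Dv : D v by case: (vmin w uw) => [->//|/Dd]; apply.
      exists v; split; first by right; case: su' => [->//|/(wo_trans wolt)]; apply.
      split=> //; case: (rc v) => _ /(_ u uv) -> // z zv.
      case: (wo_total wolt z u) => [|->|uz]; [by right|by left|].
      case: (vmin z uz) => [vz|/(wo_asym wolt zv)//].
      by rewrite -vz in zv; case: (wo_irr wolt zv).
case: (wo_history wolt D) => [eD|[s [Ds smax]]|//].
  apply: (follows_next wob _ _ (s := None)) => //; last by case: fy => ->.
  by move=> [s /eD|] //; left.
apply: (follows_next wob _ _ (s := Some s)) => //.
  by move=> [u /smax[->|]|]; [left|right|right].
by case: fy => _ /(_ s Ds smax) ->.
Qed.

End Along.

(** The setup segment comes first, then one block for each time of [c]. As every block is nonempty,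
    the resulting run is at least as long as the well-order [T]. *)
Lemma simulation (T : Type) (lt : T -> T -> Prop) (c : T -> config P)
    (init x : config P) (init' : config P') (A0 : nat -> 'I_k' -> Prop) :
  open_run lt c init x -> segment init' A0 (sim_config init) ->
  exists c' A, sim_entry x c' /\ segment_along lt init' A c'.
Proof.
move=> r s0; have [wolt [rc ex] nh] := r.
have /choice[A HA] : forall t, exists A,
    segment (if `[< (exists s, lt s t) /\
        (forall s, lt s t -> exists u, lt u t /\ lt s u) >]
      then sim_limit (ctape (c t)) else sim_config (c t)) A
      (sim_config (step (c t))) /\ sim_bounds A (c t).
  by move=> t; apply: (sim_block (nh t)); exact: entry_sim (rc t).
have fe := follows_entry init' A0 r (fun t => (HA t).2).
have ee := entry_sim ex.
do 2!eexists; split; first exact: ee.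
suff [T' [lt' [c' [r' i a [j jm]]]]] : segment_along (add_bot lt) init'
    (fun n i => exists o, (if o is Some t then A t else A0) n i)
    (if `[< (exists s : T, True) /\
        (forall s : T, True -> exists u, True /\ lt s u) >]
      then sim_limit (ctape x) else sim_config x).
  exists T', lt', c'; split=> //; first exact: a.
  by exists (fun t => j (Some t)) => s t st; apply: jm.
apply: (@segment_sum _ _ _ _ (fun o => if o is Some t then
    (if `[< (exists s, lt s t) /\
        (forall s, lt s t -> exists u, lt u t /\ lt s u) >]
      then sim_limit (ctape (c t)) else sim_config (c t)) else init') _
    (fun o => sim_config (if o is Some t then step (c t) else init))).
- exact: wo_add_bot.
- split.
    move=> [t|]; last by apply: follows_first => // -[? []|[]].
    have := fe (lt^~ t) (c t) (fun s u su ut => wo_trans wolt su ut) (rc t).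
    by congr follows; apply/funext => -[].
  have := fe (fun=> True) x (fun _ _ _ _ => I) ex.
  by congr follows; apply/funext => -[].
- by move=> [t|] //; case: (HA t).
- by exists None.
Qed.

Lemma simulation_halts (init : config P) (init' : config P')
    (A0 : nat -> 'I_k' -> Prop) (fin : config P) :
  segment init' A0 (sim_config init) -> halting_run init fin ->
  exists c' A, sim_entry fin c' /\ segment init' A c'.
Proof.
move=> s0 /halting_runP[_ [T [lt [c r]]]].
have [c' [A [ec sc]]] := simulation r s0.
by exists c', A; split=> //; exact: segment_alongW sc.
Qed.

(** The simulated machine is run along the times [T] of the halting run. If it never halts there,
    its simulation is a run of [P'] without halt into which [T] embeds, against
    [halting_at_not_longer]. *)
Lemma simulation_halts_inv (init : config P) (init' : config P')
    (A0 : nat -> 'I_k' -> Prop) (fin' : config P') :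
  segment init' A0 (sim_config init) -> halting_run init' fin' ->
  exists fin : config P, halting_run init fin.
Proof.
move=> s0 /halting_runE[T [lt [d [tend [hd _]]]]].
have [wolt top rd nhd hend] := hd.
have [c rc] := run_exists init wolt.
have [[t ht]|/forallNP nh] := pselect (exists t, Defs.cst (c t) = q_halt P).
  exact: halts_of_halting_time rc ht.
have [x ex] := follows_exists (fun t n i => ctape (c t) n i)
  (fun t => step (c t)) (fun=> True) init wolt.
have r : open_run lt c init x by [].
have [c' [A [_ [T' [lt' [d' [r' _ _ [j jm]]]]]]]] := simulation r s0.
have [wolt' [rd' _] nhd'] := r'.
by case: (halting_at_not_longer wolt wolt' rd rd' hd nhd' (j := j)).
Qed.

End Simulation.

(** * From one tape to three *)

Section ThreeTapes.
Context (P : program 1).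

Inductive copier_state :=
  | CpStart | CpCopy | CpLimit | CpSim of state P | CpHalt.

Definition copier_code (q : copier_state) : bool * bool + state P :=
  match q with
  | CpStart => inl (false, false)
  | CpCopy => inl (false, true)
  | CpLimit => inl (true, false)
  | CpHalt => inl (true, true)
  | CpSim q => inr q
  end.

Definition copier_decode (u : bool * bool + state P) : copier_state :=
  match u with
  | inl (false, false) => CpStart
  | inl (false, true) => CpCopy
  | inl (true, false) => CpLimit
  | inl (true, true) => CpHalt
  | inr q => CpSim q
  end.

Lemma copier_codeK : cancel copier_code copier_decode.
Proof. by case. Qed.

HB.instance Definition _ := Finite.copy copier_state (can_type copier_codeK).

Definition column3 (x y z : bool) : {ffun 'I_3 -> bool} :=
  [ffun i : 'I_3 => nth false [:: x; y; z] i].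

Definition tape_scratch : 'I_3 := @Ordinal 3 1 isT.

(** A mark on the scratch tape, written by the first step and erased right after the first limit,
    tells the end of the copying from the simulated limits. During the simulation the input and
    output tapes carry the same bits, so the output is in place when [P] halts. *)
Definition copier_delta (q : copier_state) (col : {ffun 'I_3 -> bool}) :
    copier_state * {ffun 'I_3 -> bool} * bool :=
  let x := col tape_in in
  match q with
  | CpStart => (CpCopy, column3 x true x, true)
  | CpCopy => (CpCopy, column3 x false x, true)
  | CpLimit => (CpSim (if col tape_scratch then q_start P else q_limit P),
                column3 x false x, false)
  | CpSim q =>
      if q == q_halt P then (CpHalt, column3 x false x, true)
      else let: (q', w, r) := delta q [ffun=> x] in
           (CpSim q', column3 (w ord0) false (w ord0), r)
  | CpHalt => (CpHalt, col, true)
  end.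

Definition copier : program 3 :=
  @Program 3 copier_state CpStart CpHalt CpLimit copier_delta.

Definition copier_cell (p : nat) (i : 'I_3) : bool + nat * 'I_1 :=
  if i == tape_scratch then inl false else inr (p, ord0).

Local Notation scfg := (@sim_config 1 3 P copier copier_cell CpSim id).
Local Notation slim := (@sim_limit 1 3 copier copier_cell).

Lemma copier_limit t h y : h = 0 ->
  step (Config (P := copier) CpLimit h
    (fun n i => if i == tape_scratch then y && (n == 0) else t n)) =
  scfg (Config (if y then q_start P else q_limit P) 0 (fun n _ => t n)).
Proof.
move=> ->; rewrite /step /= !ffunE /= eqxx andbT; apply: config_tape_eq => n i.
rewrite /encode /copier_cell ffunE.
by case: i => [[|[|[|//]]] hi]; case: n => [|n] //=; rewrite andbF.
Qed.

Lemma copier_limit_entry t : step (slim t) = scfg (Config (q_limit P) 0 t).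
Proof.
rewrite -[t in RHS](_ : (fun n _ => t n ord0) = t); last first.
  by apply/funext => n; apply/funext => i; rewrite (ord1 i).
rewrite -(@copier_limit (fun n => t n ord0) 0 false) //; congr step.
by apply: config_tape_eq => n i; rewrite /encode /copier_cell; case: ifP.
Qed.

Lemma copier_sim c : Defs.cst c <> q_halt P ->
  step (scfg c) = scfg (step c).
Proof.
case: c => q h t /eqP/negPf /= qh; rewrite /step /sim_config /= qh.
have -> : [ffun=> [ffun i => encode copier_cell t h i] tape_in] = [ffun i => t h i].
  by apply/ffunP => i; rewrite !ffunE /encode /= (ord1 i).
case: (delta q [ffun i => t h i]) => [[q' w] r] /=.
apply: config_tape_eq => n i; rewrite /encode /copier_cell ffunE.
by case: i => [[|[|[|//]]] hi] //=; case: eqP => //= ->.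
Qed.

Lemma copier_block c c' : Defs.cst c <> q_halt P ->
  @sim_entry 1 3 P copier copier_cell CpSim id c c' ->
  exists A, segment c' A (scfg (step c)) /\
    sim_bounds copier_cell A c.
Proof.
move=> rc [->|[t [ct ->]]].
  exists (fun n i => ctape (scfg c) n i); split; last by split=> // p i ?; left.
  by rewrite -copier_sim //; apply: segment_step.
have e1 : step (slim t) = scfg c by rewrite copier_limit_entry ct.
have [|p i||A [sA lA uA]] := @reach_segment _ _ (fun p i => ctape (slim t) p i)
    (slim t) (scfg (step c)) _ _ _ => //.
  rewrite e1; apply: reach_step => //.
    by move=> p i; rewrite /= ct.
  by rewrite copier_sim //; exact: reach_refl.
exists A; split=> //; rewrite ct; split=> [p i /lA//|p i /uA]; by left.
Qed.

Lemma copier_setup a :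
  exists A, segment (init3 copier a) A (scfg (init1 P a)).
Proof.
pose D n := Config (P := copier) (if n is 0 then CpStart else CpCopy) n
  (fun p i => if i == tape_scratch then (0 < n) && (p == 0)
              else if i == tape_out then (p < n) && a p else a p).
pose t : nat -> 'I_3 -> bool :=
  fun p i => if i == tape_scratch then true && (p == 0) else a p.
have [||||p i|A [sA _ _]] := @reach_omega_segment _ copier (fun _ _ => True)
    (init3 copier a) D t.
- have -> : init3 copier a = D 0; last exact: reach_refl.
  by apply: config_tape_eq => p [[|[|[|//]]] hi].
- move=> n; rewrite /D /step /=.
  have -> : copier_delta match n with 0 => CpStart | _.+1 => CpCopy end
      [ffun i => if i == tape_scratch then (0 < n) && (n == 0)
                 else if i == tape_out then (n < n) && a n else a n] =
      (CpCopy, column3 (a n) (n == 0) (a n), true).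
    by case: n => [|n] /=; rewrite ffunE.
  apply: config_tape_eq => p i; rewrite ffunE.
  case: i => [[|[|[|//]]] hi] //=; case: eqP => [->|np] //=.
  + by case: n.
  + by rewrite andbF; case: eqP np => // ->; case: n.
  + by rewrite ltnS leqnn.
  + by rewrite ltnS [in LHS]leq_eqVlt; case: eqP.
- by case.
- by [].
- exists p.+1 => n pn; rewrite /D /t /=; case: ifP => // _.
    by rewrite (leq_ltn_trans _ pn).
  by case: ifP => // _; rewrite pn.
exists (fun p i => A p i \/ t p i).
have := @copier_limit a 0 true erefl; rewrite /= => <-.
by apply: segment_cat sA _; apply: segment_step.
Qed.

Lemma copier_finish c c' : Defs.cst c = q_halt P ->
  @sim_entry 1 3 P copier copier_cell CpSim id c c' ->
  exists fin A, [/\ segment c' A fin, Defs.cst fin = CpHalt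
    & forall n, ctape fin n tape_out = ctape c n ord0].
Proof.
move=> hc ec.
have fin0 : step (scfg c) = Config (P := copier) CpHalt (chead c).+1
    (ctape (scfg c)).
  case: c hc {ec} => q h t /= ->; rewrite /step /= eqxx.
  apply: config_tape_eq => n i; rewrite /encode /copier_cell !ffunE.
  by case: i => [[|[|[|//]]] hi] //=; case: eqP => //= ->.
have s0 : segment (scfg c) (fun n i => ctape (scfg c) n i) (step (scfg c)).
  exact: segment_step.
case: ec => [->|[t [ct ->]]].
  by exists (step (scfg c)); eexists; split; [exact: s0|rewrite fin0..].
exists (step (scfg c)); eexists; split; [|by rewrite fin0..].
apply: segment_cat s0; rewrite ct -copier_limit_entry; exact: segment_step.
Qed.
End ThreeTapes.

Lemma ittm_of_one_tape (f : (nat -> bool) -> option (nat -> bool)) :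
  (exists P : program 1, forall a b, ittm1_computes P a b <-> f a = Some b) ->
  exists P : program 3, forall a b, ittm_computes P a b <-> f a = Some b.
Proof.
move=> [P fP]; exists (copier P) => a b; have [A0 s0] := copier_setup P a.
have fwd b' : f a = Some b' -> ittm_computes (copier P) a b'.
  move=> /fP[fin [hfin fb]].
  have [c' [A [ec sc]]] := simulation_halts (@copier_block P) s0 hfin.
  have hf : Defs.cst fin = q_halt P by case/halting_runP: hfin.
  have [fin' [B [sB hfin' out]]] := copier_finish hf ec.
  exists fin'; split; last by move=> n; rewrite fb out.
  exact: segment_halting (segment_cat sc sB) hfin'.
split; last exact: fwd.
move=> [fin' [hfin' fb]].
(* Halting of the simulating machine yields halting of [P], hence a value of [f]; this value is [b]
   because all halting runs from one configuration end alike. *)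
have [fin hfin] := simulation_halts_inv (@copier_block P) s0 hfin'.
have fa : f a = Some (fun n => ctape fin n ord0) by apply/fP; exists fin.
have [fin2 [hfin2 fb2]] := fwd _ fa.
rewrite fa; congr Some; apply/funext => n.
by rewrite fb fb2 (halting_run_uniq hfin' hfin2).
Qed.

(** * The one-tape machine *)

Definition upd (t : nat -> bool) (h : nat) (w : bool) (n : nat) : bool :=
  if n == h then w else t n.

Lemma upd_id t h : upd t h (t h) = t.
Proof. by apply/funext => n; rewrite /upd; case: eqP => [->|]. Qed.

Section OneTape.
Context (P : program 3) (s : seq bool).

Local Notation m := (size s).

(* [BWalk d i r]: make [i] more moves in direction [d], then enter
   [BSkip] ([r = inl true]), [BHome] ([r = inl false]) or [BSim q] ([r = inr q]). *)
Inductive block_state :=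
  | BShiftInit of (m.+2).-tuple bool
  | BShift of 4.-tuple bool
  | BCheck of 'I_m.+1
  | BFlash | BUnflash | BSkip | BInsert
  | BEnter | BResume
  | BSim of state P
  | BRead1 of state P
  | BRead2 of state P & bool
  | BRead3 of state P & bool & bool
  | BRead4 of state P & bool & bool & bool
  | BWrite2 of state P & bool & bool & bool & bool
  | BWrite1 of state P & bool & bool & bool
  | BWalk of bool & 'I_8 & bool + state P
  | BHome | BFront
  | BClear of 'I_m.+1
  | BGoRight
  | BConsume of 'I_4
  | BGoLeft of bool
  | BPut | BHalt.

Local Notation Q := (state P).
Local Notation code_type :=
  ('I_11 + (m.+2).-tuple bool + 4.-tuple bool + 'I_m.+1 + Q + Q
   + Q * bool + Q * bool * bool + Q * bool * bool * bool
   + Q * bool * bool * bool * bool + Q * bool * bool * bool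
   + bool * 'I_8 * (bool + Q) + 'I_m.+1 + 'I_4 + bool)%type.

Definition block_code (q : block_state) : code_type :=
  match q with
  | BGoLeft b => inr b
  | BConsume i => inl (inr i)
  | BClear i => inl (inl (inr i))
  | BWalk d i r => inl (inl (inl (inr (d, i, r))))
  | BWrite1 q c r w0 => inl (inl (inl (inl (inr (q, c, r, w0)))))
  | BWrite2 q c r w0 w1 => inl (inl (inl (inl (inl (inr (q, c, r, w0, w1))))))
  | BRead4 q c x y => inl (inl (inl (inl (inl (inl (inr (q, c, x, y)))))))
  | BRead3 q c x => inl (inl (inl (inl (inl (inl (inl (inr (q, c, x))))))))
  | BRead2 q c => inl (inl (inl (inl (inl (inl (inl (inl (inr (q, c)))))))))
  | BRead1 q => inl (inl (inl (inl (inl (inl (inl (inl (inl (inr q)))))))))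
  | BSim q => inl (inl (inl (inl (inl (inl (inl (inl (inl (inl (inr q))))))))))
  | BCheck i =>
      inl (inl (inl (inl (inl (inl (inl (inl (inl (inl (inl (inr i)))))))))))
  | BShift u =>
      inl (inl (inl (inl (inl (inl (inl (inl (inl (inl (inl (inl
        (inr u))))))))))))
  | BShiftInit u =>
      inl (inl (inl (inl (inl (inl (inl (inl (inl (inl (inl (inl (inl
        (inr u)))))))))))))
  | q => inl (inl (inl (inl (inl (inl (inl (inl (inl (inl (inl (inl (inl (inl
      match q with
      | BFlash => @Ordinal 11 0 isT
      | BUnflash => @Ordinal 11 1 isT
      | BSkip => @Ordinal 11 2 isT
      | BInsert => @Ordinal 11 3 isT
      | BEnter => @Ordinal 11 4 isT
      | BResume => @Ordinal 11 5 isT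
      | BHome => @Ordinal 11 6 isT
      | BFront => @Ordinal 11 7 isT
      | BGoRight => @Ordinal 11 8 isT
      | BPut => @Ordinal 11 9 isT
      | _ => @Ordinal 11 10 isT
      end)))))))))))))
  end.

Definition block_decode (u : code_type) : block_state :=
  match u with
  | inr b => BGoLeft b
  | inl (inr i) => BConsume i
  | inl (inl (inr i)) => BClear i
  | inl (inl (inl (inr (d, i, r)))) => BWalk d i r
  | inl (inl (inl (inl (inr (q, c, r, w0))))) => BWrite1 q c r w0
  | inl (inl (inl (inl (inl (inr (q, c, r, w0, w1)))))) => BWrite2 q c r w0 w1
  | inl (inl (inl (inl (inl (inl (inr (q, c, x, y))))))) => BRead4 q c x y
  | inl (inl (inl (inl (inl (inl (inl (inr (q, c, x)))))))) => BRead3 q c x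
  | inl (inl (inl (inl (inl (inl (inl (inl (inr (q, c))))))))) => BRead2 q c
  | inl (inl (inl (inl (inl (inl (inl (inl (inl (inr q))))))))) => BRead1 q
  | inl (inl (inl (inl (inl (inl (inl (inl (inl (inl (inr q)))))))))) => BSim q
  | inl (inl (inl (inl (inl (inl (inl (inl (inl (inl (inl (inr i)))))))))))
      => BCheck i
  | inl (inl (inl (inl (inl (inl (inl (inl (inl (inl (inl (inl
      (inr u)))))))))))) => BShift u
  | inl (inl (inl (inl (inl (inl (inl (inl (inl (inl (inl (inl (inl
      (inr u))))))))))))) => BShiftInit u
  | inl (inl (inl (inl (inl (inl (inl (inl (inl (inl (inl (inl (inl (inl i)
      )))))))))))) =>
      nth BHalt [:: BFlash; BUnflash; BSkip; BInsert; BEnter; BResume; BHome;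
                    BFront; BGoRight; BPut] i
  end.

Lemma block_codeK : cancel block_code block_decode.
Proof. by case. Qed.

HB.instance Definition _ := Finite.copy block_state (can_type block_codeK).

Definition land (r : bool + Q) : block_state :=
  match r with
  | inl true => BSkip
  | inl false => BHome
  | inr q => BSim q
  end.

Definition walk (d : bool) (n : nat) (r : bool + Q) : block_state :=
  if n is 0 then land r else BWalk d (inord n) r.

(** The shifting states keep the cells still to be written in a queue. [BCheck] follows every limit:
    a mismatch with [s] halts, flag 1 enters the simulation, flag 0 starts a setup phase. [BResume]
    reads the mark of column 0, absent only at the end of the setup. The reading and writing states
    process one column; the states from [BHome] on move the output bits to the front. *)
Definition block_delta (q : block_state) (x : bool) :
    block_state * bool * bool :=
  match q with
  | BShiftInit u => (BShiftInit [tuple of behead (rcons u x)], head x u, true)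
  | BShift u => (BShift [tuple of behead (rcons u x)], head x u, true)
  | BCheck i =>
      if i < m then
        (if x == nth false s i then BCheck (inord i.+1) else BHalt, x, true)
      else if x then (BEnter, x, true) else (BFlash, true, true)
  | BFlash => (BUnflash, x, false)
  | BUnflash => (BSkip, false, true)
  | BSkip => if x then (walk true 4 (inl true), x, true)
             else (BInsert, true, true)
  | BInsert => (BShift [tuple x; false; false; false], false, true)
  | BEnter => (BResume, x, true)
  | BResume => (BSim (if x then q_limit P else q_start P), true, false)
  | BSim q => (if q == q_halt P then BHome else BRead1 q, x, true)
  | BRead1 q => (BRead2 q x, x, true)
  | BRead2 q c => (BRead3 q c x, x, true)
  | BRead3 q c x0 => (BRead4 q c x0 x, x, true)
  | BRead4 q c x0 x1 =>
      let: (q', w, r) := delta q (column3 x0 x1 x) in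
      (BWrite2 q' c r (w tape_in) (w tape_scratch), w tape_out, false)
  | BWrite2 q c r w0 w1 => (BWrite1 q c r w0, w1, false)
  | BWrite1 q c r w0 =>
      (if r then walk true 2 (inr q)
       else walk false (if c then 1 else 6) (inr q), w0, r)
  | BWalk d i r => (walk d i.-1 r, x, d)
  | BHome => if x then (BFront, x, false) else (walk false 4 (inl false), x, false)
  | BFront => (BClear (inord m), x, false)
  | BClear i => if i == 0 :> nat then (BGoRight, true, true)
                else (BClear (inord i.-1), false, false)
  | BGoRight => if x then (BConsume (inord 3), false, true)
                else (BGoRight, x, true)
  | BConsume i => if i == 0 :> nat then (BGoLeft x, false, false)
                  else (BConsume (inord i.-1), false, true)
  | BGoLeft b => if x then (BPut, b, true) else (BGoLeft b, x, false)
  | BPut => (BGoRight, true, true)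
  | BHalt => (BHalt, x, true)
  end.

(** The initial queue: [s], then the flag 0, then the terminator 0 of a still empty list of
    blocks. *)
Lemma size_sentinels : size (s ++ [:: false; false]) == m.+2.
Proof. by rewrite size_cat addn2. Qed.

Definition block_machine : program 1 :=
  @Program 1 block_state (BShiftInit (Tuple size_sentinels)) BHalt
    (BCheck ord0)
    (fun q col => let: (q', w, r) := block_delta q (col ord0) in
                  (q', [ffun=> w], r)).

Local Notation PB := block_machine.

Definition mk (q : block_state) (h : nat) (t : nat -> bool) : config PB :=
  Config (P := PB) q h (fun n _ => t n).

Lemma step_mk q h t q' w r : block_delta q (t h) = (q', w, r) ->
  step (mk q h t) = mk q' (if r then h.+1 else h.-1) (upd t h w).
Proof.
move=> dE; rewrite /step /mk /= ffunE dE.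
by apply: config_tape_eq => n i; rewrite ffunE.
Qed.

Implicit Types (t : nat -> bool).

Definition breach (S : nat -> Prop) := @reach 1 PB (fun p _ => S p).

Lemma breach_step (S : nat -> Prop) q h t c q' w r h' t' :
  block_delta q (t h) = (q', w, r) -> q <> BHalt -> (forall p, t p -> S p) ->
  h' = (if r then h.+1 else h.-1) -> t' = upd t h w ->
  breach S (mk q' h' t') c -> breach S (mk q h t) c.
Proof.
by move=> dE qh tS -> ->; rewrite -(step_mk dE) => H; apply: reach_step => // p i; apply: tS.
Qed.

Lemma breach_keep (S : nat -> Prop) q h t c q' r h' :
  block_delta q (t h) = (q', t h, r) -> q <> BHalt -> (forall p, t p -> S p) ->
  h' = (if r then h.+1 else h.-1) ->
  breach S (mk q' h' t) c -> breach S (mk q h t) c.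
Proof.
by move=> dE qh tS hE; apply: (breach_step dE qh tS hE); rewrite upd_id.
Qed.

Lemma breach_walk (S : nat -> Prop) d n r h t : n < 8 -> (forall p, t p -> S p) ->
  breach S (mk (walk d n r) h t) (mk (land r) (if d then h + n else h - n) t).
Proof.
move=> n8 tS; elim: n h n8 => [|n IH] h n8.
  by rewrite /walk addn0 subn0 if_same; exact: reach_refl.
have -> : (if d then h + n.+1 else h - n.+1) =
    (if d then (if d then h.+1 else h.-1) + n else (if d then h.+1 else h.-1) - n).
  by case: d {IH}; lia.
apply: (breach_keep (q' := walk d n r) (r := d)) => //; last by apply: IH; lia.
by rewrite /= inordK.
Qed.

Lemma breach_check (S : nat -> Prop) n t : n <= m -> (forall p, t p -> S p) ->
  (forall p, p < n -> t p = nth false s p) ->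
  breach S (mk (BCheck ord0) 0 t) (mk (BCheck (inord n)) n t).
Proof.
move=> nm tS ts; elim: n nm ts => [|n IH] nm ts.
  have -> : ord0 = inord 0 :> 'I_m.+1 by apply: val_inj; rewrite /= inordK.
  exact: reach_refl.
apply: reach_trans (IH _ _) _; [lia|by move=> p pn; apply: ts; lia|].
apply: (breach_keep (q' := BCheck (inord n.+1)) (r := true)) => //; last exact: reach_refl.
by rewrite /= inordK ?nm ?ts ?eqxx //; lia.
Qed.

(** The first step is singled out so that the segment has a time even when its two ends coincide. *)
Lemma segment_of_breach (S : nat -> Prop) q h t c q' w r :
  block_delta q (t h) = (q', w, r) -> q <> BHalt -> (forall p, t p -> S p) ->
  breach S (mk q' (if r then h.+1 else h.-1) (upd t h w)) c ->
  exists A, [/\ segment (mk q h t) A c, forall p i, t p -> A p i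
             & forall p i, A p i -> S p].
Proof.
move=> dE qh tS H; have [//|||A [sA lA uA]] := @reach_segment 1 PB (fun p _ => S p) (mk q h t) c.
- by move=> p i; apply: tS.
- by rewrite (step_mk dE).
by exists A; split.
Qed.

Definition window (E : nat -> bool) (h d : nat) : seq bool :=
  mkseq (fun i => E (h + i)) d.

Lemma window_shift E h d :
  behead (rcons (window E h d) (E (h + d))) = window E h.+1 d.
Proof.
rewrite /window /mkseq -(map_rcons (fun i => E (h + i))) -cats1.
have -> : iota 0 d ++ [:: d] = iota 0 d.+1 by rewrite -addn1 iotaD.
rewrite /= (iotaDl 1 0) -map_comp; apply: eq_map => i /=.
by rewrite add1n addnS addSn.
Qed.

(** At head position [h] the queue holds the [d] cells of [E'] from [h] on. Writing its first bit
    and appending the scanned [E h], which equals [E' (h + d)], keeps this true. Each cell from [p0]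
    on is passed once, so the limit tape is [E']. *)
Lemma shift_segment (d : nat) (Sh : d.-tuple bool -> block_state)
    (S : nat -> Prop) (c0 : config PB) (E E' : nat -> bool) (p0 : nat)
    (u0 : d.-tuple bool) :
  (forall u x, block_delta (Sh u) x = (Sh [tuple of behead (rcons u x)], head x u, true)) ->
  (forall u, Sh u <> BHalt) -> 0 < d ->
  val u0 = window E' p0 d -> (forall x, p0 <= x -> E' (x + d) = E x) ->
  (forall p, E p -> S p) -> (forall p, E' p -> S p) ->
  breach S c0 (mk (Sh u0) p0 (fun p => if p < p0 then E' p else E p)) ->
  exists A, [/\ segment c0 A (mk (BCheck ord0) 0 E'),
                forall p i, ctape c0 p i -> A p i & forall p i, A p i -> S p].
Proof.
move=> ShE ShH d0 u0E E'E ES E'S H.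
have sz h : size (window E' h d) == d by rewrite size_mkseq.
pose D n := mk (Sh (Tuple (sz (p0 + n)))) (p0 + n)
  (fun p => if p < p0 + n then E' p else E p).
have [|||n p i|p i|A HA] := @reach_omega_segment 1 PB (fun p _ => S p) c0 D (fun p _ => E' p).
- rewrite /D addn0; have -> : Tuple (sz p0) = u0 by apply: val_inj; rewrite /= u0E.
  exact: H.
- move=> n; rewrite /D.
  have -> : step (mk (Sh (Tuple (sz (p0 + n)))) (p0 + n)
      (fun p => if p < p0 + n then E' p else E p)) = _ := step_mk (ShE _ _).
  rewrite ltnn addnS; apply: (f_equal2 (fun q t => mk (Sh q) (p0 + n).+1 t)).
    apply: val_inj; rewrite /= -E'E; last by lia.
    by rewrite window_shift.
  apply/funext => p; rewrite /upd ltnS.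
  have -> : head (E (p0 + n)) (window E' (p0 + n) d) = E' (p0 + n).
    by rewrite -nth0 nth_mkseq // addn0.
  by rewrite leq_eqVlt; case: eqP => [->|].
- by move=> n; apply: ShH.
- by rewrite /=; case: ifP => _; [exact: E'S|exact: ES].
- exists p.+1 => n pn; rewrite /D /=; case: ifP => //; lia.
by exists A.
Qed.

End OneTape.

(** * Simulation on one tape *)

Section BlockSimulation.
Context (P : program 3) (s : seq bool).
Implicit Types (t : nat -> 'I_3 -> bool).

Local Notation m := (size s).
Local Notation PB := (block_machine P s).
Local Notation mk := (@mk P s).
Local Notation breach := (@breach P s).

Definition block_pos (h : nat) : nat := (m + 5 * h).+1.

Local Notation pos := block_pos.

(* The tape holds [s], the flag 1, then for each column [h] of [P] the block
   [1, h == 0, input, scratch, output] starting at [pos h]. *)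
Definition block_cell (p : nat) (i : 'I_1) : bool + nat * 'I_3 :=
  if p < m then inl (nth false s p) else
  if p == m then inl true else
  let h := (p - m.+1) %/ 5 in
  match (p - m.+1) %% 5 with
  | 0 => inl true
  | 1 => inl (h == 0)
  | 2 => inr (h, tape_in)
  | 3 => inr (h, tape_scratch)
  | _ => inr (h, tape_out)
  end.

Definition blocks (t : nat -> 'I_3 -> bool) (p : nat) : bool :=
  encode block_cell t p ord0.

Lemma posP p :
  [\/ p < m, p = m | exists h j, j < 5 /\ p = pos h + j].
Proof.
case: (ltngtP p m) => [||]; [by constructor 1| |by constructor 2].
move=> mp; constructor 3; exists ((p - m.+1) %/ 5), ((p - m.+1) %% 5).
by rewrite ltn_mod; split=> //; rewrite /block_pos; lia.
Qed.

Lemma block_cell_pos h j i : j < 5 -> block_cell (pos h + j) i =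
  match j with
  | 0 => inl true
  | 1 => inl (h == 0)
  | 2 => inr (h, tape_in)
  | 3 => inr (h, tape_scratch)
  | _ => inr (h, tape_out)
  end.
Proof.
move=> j5; rewrite /block_cell.
have -> : (pos h + j < m) = false by rewrite /block_pos; lia.
have -> : (pos h + j == m) = false by rewrite /block_pos; lia.
have -> : pos h + j - m.+1 = h * 5 + j by rewrite /block_pos; lia.
by rewrite divnMDl // modnMDl divn_small // modn_small // addn0.
Qed.

Lemma blocks_front t p : p < m -> blocks t p = nth false s p.
Proof. by move=> pm; rewrite /blocks /encode /block_cell pm. Qed.

Lemma blocks_flag t : blocks t m.
Proof. by rewrite /blocks /encode /block_cell ltnn eqxx. Qed.

Lemma blocks_pos t h j : j < 5 -> blocks t (pos h + j) =
  match j with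
  | 0 => true
  | 1 => h == 0
  | 2 => t h tape_in
  | 3 => t h tape_scratch
  | _ => t h tape_out
  end.
Proof.
by move=> j5; rewrite /blocks /encode block_cell_pos //; case: j j5 => [|[|[|[|]]]].
Qed.

Lemma blocks_pos0 t h : blocks t (pos h).
Proof. by rewrite -[pos h]addn0 blocks_pos. Qed.

Lemma pos_eq h h' j j' : j < 5 -> j' < 5 ->
  (pos h + j == pos h' + j') = (h == h') && (j == j').
Proof. by move=> *; rewrite /block_pos; lia. Qed.

Local Notation scfg := (@sim_config 3 1 P PB block_cell (@BSim P s) pos).
Local Notation slim := (@sim_limit 3 1 PB block_cell).

Lemma scfgE q h t : scfg (Config q h t) = mk (BSim s q) (pos h) (blocks t).
Proof. by []. Qed.

Lemma slimE t : slim t = mk (BCheck P ord0) 0 (blocks t).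
Proof. by []. Qed.

Lemma breach_blocks_front (S : nat -> Prop) t : (forall p, blocks t p -> S p) ->
  breach S (mk (BCheck P ord0) 0 (blocks t)) (mk (BCheck P (inord m)) m (blocks t)).
Proof. by move=> tS; apply: breach_check => // p; apply: blocks_front. Qed.

(** The tape starts with [s], the flag is 1 and column 0 is marked, so the limit is recognised as
    one of [P] and the simulation resumes in [q_limit P] on the same tape. *)
Lemma breach_limit_entry (S : nat -> Prop) t : (forall p, blocks t p -> S p) ->
  breach S (slim t) (scfg (Config (q_limit P) 0 t)).
Proof.
move=> tS; rewrite slimE scfgE; apply: reach_trans (breach_blocks_front tS) _.
apply: (breach_keep (q' := BEnter P s) (r := true)) => //.
  by rewrite /= inordK // ltnn blocks_flag.
apply: (breach_keep (q' := BResume P s) (r := true)) => //.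
apply: (breach_keep (q' := BSim s (q_limit P)) (r := false)) => //.
  have -> : m.+2 = pos 0 + 1 by rewrite /block_pos; lia.
  by rewrite blocks_pos.
rewrite /block_pos muln0 addn0; exact: reach_refl.
Qed.

Lemma blocks_update t h (w : 'I_3 -> bool) :
  blocks (fun n i => if n == h then w i else t n i) =
  upd (upd (upd (blocks t) (pos h + 4) (w tape_out))
    (pos h + 3) (w tape_scratch)) (pos h + 2) (w tape_in).
Proof.
apply/funext => p; rewrite /upd.
case: (posP p) => [pm|->|[h' [j [j5 ->]]]].
- rewrite !blocks_front //; do 3!(case: eqP => [|_]; first by rewrite /block_pos; lia).
  by [].
- rewrite !blocks_flag; do 3!(case: eqP => [|_]; first by rewrite /block_pos; lia).
  by [].
- rewrite !pos_eq // !blocks_pos //; case: (h' =P h) => [->|_] /=.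
    by case: j j5 => [|[|[|[|[|]]]]].
  by [].
Qed.

Lemma breach_sim_step c : Defs.cst c <> q_halt P ->
  breach (fun p => blocks (ctape c) p \/ blocks (ctape (step c)) p)
    (mk (BRead1 s (Defs.cst c)) (pos (chead c)).+1 (blocks (ctape c)))
    (scfg (step c)).
Proof.
case: c => q h t /= qh; rewrite /step /=.
case dE: (delta q [ffun i => t h i]) => [[q' w] r] /=.
set t' := (fun n i => if n == h then w i else t n i); set S := fun p => _ \/ _.
have t'E := blocks_update t h w; rewrite -/t' in t'E.
have tS p : blocks t p -> S p by left.
(* The tapes after the first and the second of the three writes; each of their cells has its old or
   its new value, as [S] demands. *)
pose t2 := upd (blocks t) (pos h + 4) (w tape_out).
pose t1 := upd t2 (pos h + 3) (w tape_scratch).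
have t2S p : t2 p -> S p.
  rewrite /t2 /upd; case: eqP => [-> wo|_]; last exact: tS.
  by right; rewrite /t' blocks_pos // eqxx.
have t1S p : t1 p -> S p.
  rewrite /t1 {1}/upd; case: eqP => [-> wo|_]; last exact: t2S.
  by right; rewrite /t' blocks_pos // eqxx.
have t'S p : blocks t' p -> S p by right.
apply: (breach_keep (q' := BRead2 s q (h == 0)) (r := true) (h' := pos h + 2)) => //.
- by rewrite -addn1 blocks_pos.
- by rewrite addn2.
apply: (breach_keep (q' := BRead3 s q (h == 0) (t h tape_in)) (r := true)
  (h' := pos h + 3)) => //.
- by rewrite /= blocks_pos.
- by rewrite addnS.
apply: (breach_keep (q' := BRead4 s q (h == 0) (t h tape_in) (t h tape_scratch))
  (r := true) (h' := pos h + 4)) => //.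
- by rewrite /= blocks_pos.
- by rewrite addnS.
apply: (breach_step (q' := BWrite2 s q' (h == 0) r (w tape_in) (w tape_scratch))
  (w := w tape_out) (r := false) (h' := pos h + 3) (t' := t2)) => //.
- rewrite /= blocks_pos //.
  have -> : column3 (t h tape_in) (t h tape_scratch) (t h tape_out) = [ffun i => t h i].
    apply/ffunP => i; rewrite !ffunE; case: i => [[|[|[|//]]] hi] /=;
    by congr (t h); apply: val_inj.
  by rewrite dE.
- by rewrite !addnS.
apply: (breach_step (q' := BWrite1 s q' (h == 0) r (w tape_in))
  (w := w tape_scratch) (r := false) (h' := pos h + 2) (t' := t1)) => //.
  by rewrite !addnS.
apply: (breach_step (q' := if r then walk s true 2 (inr q')
    else walk s false (if h == 0 then 1 else 6) (inr q'))
  (w := w tape_in) (r := r) (h' := if r then pos h + 3 else pos h + 1)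
  (t' := blocks t')) => //.
  by rewrite !addnS.
rewrite scfgE; case: {dE} r.
  have -> : pos h.+1 = pos h + 3 + 2 by rewrite /block_pos; lia.
  exact: (@breach_walk P s S true 2 (inr q') (pos h + 3)).
(* From cell 1 of block [h], six moves left reach the start of the previous block. In column 0 the
   simulated head stays in place, so a single move back to the start of the block is right. *)
set d := if h == 0 then 1 else 6.
have -> : pos h.-1 = pos h + 1 - d.
  by rewrite /block_pos /d -subn1; case: eqP; lia.
by apply: (@breach_walk P s S false d (inr q') (pos h + 1)) => //; rewrite /d; case: ifP.
Qed.

Lemma block_block c c' : Defs.cst c <> q_halt P ->
  @sim_entry 3 1 P PB block_cell (@BSim P s) pos c c' ->
  exists A, segment c' A (scfg (step c)) /\ sim_bounds block_cell A c.
Proof.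
move=> rc ec.
pose S p := blocks (ctape c) p \/ blocks (ctape (step c)) p.
have tS p : blocks (ctape c) p -> S p by left.
have H : breach S (scfg c) (scfg (step c)).
  apply: (breach_keep (q' := BRead1 s (Defs.cst c)) (r := true)) => //;
    last exact: breach_sim_step.
  by rewrite /=; case: eqP.
suff [A [sA lA uA]] : exists A, [/\ segment c' A (scfg (step c)),
    forall p i, blocks (ctape c) p -> A p i & forall p i, A p i -> S p].
  exists A; split; first exact: sA.
  split; first by move=> p i; rewrite (ord1 i); exact: lA.
  by move=> p i; rewrite (ord1 i); exact: uA.
case: ec => [->|[t [ct ->]]].
  (* [P] may stay in the same configuration, so the segment is built from its first step and not
     from a difference of its ends. *)
  apply: (segment_of_breach (S := S) (q' := BRead1 s (Defs.cst c)) (r := true)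
    (w := blocks (ctape c) (pos (chead c)))) => //.
    by rewrite /=; case: eqP.
  by rewrite upd_id; apply: breach_sim_step.
rewrite ct in tS H *; apply: (@reach_neq_segment 1 PB (fun p _ => S p)).
  by apply: reach_trans H; apply: breach_limit_entry.
by case.
Qed.

End BlockSimulation.

(** * Setup *)

Section BlockSetup.
Context (P : program 3) (s : seq bool) (a : nat -> bool).

Local Notation m := (size s).
Local Notation PB := (block_machine P s).
Local Notation mk := (@mk P s).
Local Notation breach := (@breach P s).
Local Notation pos := (block_pos s).
Local Notation tin := (ctape (init3 P a)).

(* The mark of column 0 is still missing: it is how the machine recognises the
   end of the setup among all later limits. *)
Definition fresh : nat -> bool := upd (blocks s tin) (pos 0 + 1) false.

(* The tape at the start of phase [n]: [n] finished blocks, a terminator 0, and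
   the rest of the input. *)
Definition raw (n p : nat) : bool :=
  if p == m then false else
  if p < pos n then fresh p else
  if p == pos n then false else a (n + p - (pos n).+1).

Lemma fresh_front p : p < m -> fresh p = nth false s p.
Proof.
move=> pm; rewrite /fresh /upd; case: eqP => [|_]; first by rewrite /block_pos; lia.
exact: blocks_front.
Qed.

Lemma fresh_flag : fresh m.
Proof.
rewrite /fresh /upd; case: eqP => [|_]; first by rewrite /block_pos; lia.
exact: blocks_flag.
Qed.

Lemma fresh_pos h j : j < 5 -> fresh (pos h + j) =
  match j with 0 => true | 2 => a h | _ => false end.
Proof.
move=> j5; rewrite /fresh /upd pos_eq // blocks_pos //.
by case: j j5 => [|[|[|[|[|]]]]] //=; case: h.
Qed.

Lemma raw_near n p : p <> m -> p < pos n -> raw n p = fresh p.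
Proof. by move=> /eqP/negPf pm pn; rewrite /raw pm pn. Qed.

Lemma raw_flag n : raw n m = false.
Proof. by rewrite /raw eqxx. Qed.

Lemma raw_pos n : raw n (pos n) = false.
Proof. by rewrite /raw eqxx ltnn if_same. Qed.

Lemma raw_far n p : pos n < p -> raw n p = a (n + p - (pos n).+1).
Proof.
move=> np; rewrite /raw; case: eqP => [pm|_]; first by move: np; rewrite /block_pos; lia.
case: ltnP => [|_]; first by lia.
by case: eqP => [|_ //]; lia.
Qed.

Lemma raw_front n p : p < m -> raw n p = nth false s p.
Proof.
by move=> pm; rewrite raw_near ?fresh_front // ; [lia|rewrite /block_pos; lia].
Qed.

Lemma raw_done n h j : h < n -> j < 5 ->
  raw n (pos h + j) = match j with 0 => true | 2 => a h | _ => false end.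
Proof.
by move=> hn j5; rewrite raw_near ?fresh_pos //; rewrite /block_pos; lia.
Qed.

Section Phase.
Context (n : nat).

Let S p : Prop := raw n p \/ raw n.+1 p \/ p = m.

Let rawS p : raw n p -> S p. Proof. by left. Qed.
Let raw1S p : raw n.+1 p -> S p. Proof. by right; left. Qed.

Let flashS p : upd (raw n) m true p -> S p.
Proof. by rewrite /upd; case: eqP => [-> _|_]; [right; right|exact: rawS]. Qed.

Lemma phase_flash :
  breach S (mk (BCheck P ord0) 0 (raw n)) (mk (BFlash P s) m.+1 (upd (raw n) m true)).
Proof.
apply: (reach_trans (c2 := mk (BCheck P (inord m)) m (raw n))).
  by apply: breach_check => // p; apply: raw_front.
apply: (breach_step (q' := BFlash P s) (w := true) (r := true)) => //.
  by rewrite /= inordK // ltnn raw_flag.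
exact: reach_refl.
Qed.

Lemma phase_unflash :
  breach S (mk (BFlash P s) m.+1 (upd (raw n) m true)) (mk (BSkip P s) (pos 0) (raw n)).
Proof.
apply: (breach_keep (q' := BUnflash P s) (r := false)) => //.
apply: (breach_step (q' := BSkip P s) (w := false) (r := true) (h' := pos 0)
  (t' := raw n)) => //.
- by rewrite /block_pos muln0 addn0.
- apply/funext => p; rewrite /upd; case: eqP => [->|//].
  by rewrite raw_flag.
exact: reach_refl.
Qed.

Lemma phase_skip k : k <= n ->
  breach S (mk (BSkip P s) (pos 0) (raw n)) (mk (BSkip P s) (pos k) (raw n)).
Proof.
elim: k => [|k IH] kn; first exact: reach_refl.
apply: reach_trans (IH _) _; first exact: ltnW.
apply: (breach_keep (q' := walk s true 4 (inl true)) (r := true)) => //.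
  by rewrite -[pos k]addn0 raw_done.
have -> : pos k.+1 = (pos k).+1 + 4 by rewrite /block_pos; lia.
exact: (@breach_walk P s S true 4 (inl true) (pos k).+1).
Qed.

Lemma phase_insert :
  breach S (mk (BSkip P s) (pos n) (raw n))
    (mk (BShift P s [tuple a n; false; false; false]) (pos n + 2)
      (fun p => if p < pos n + 2 then raw n.+1 p else raw n p)).
Proof.
apply: (breach_step (q' := BInsert P s) (w := true) (r := true)
  (h' := pos n + 1) (t' := upd (raw n) (pos n) true)) => //.
- by rewrite raw_pos.
- by rewrite addn1.
apply: (breach_step (q' := BShift P s [tuple a n; false; false; false])
  (w := false) (r := true) (h' := pos n + 2)
  (t' := fun p => if p < pos n + 2 then raw n.+1 p else raw n p)).
- rewrite /upd; case: eqP => [|_]; first by lia.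
  rewrite raw_far; last by lia.
  by have -> : n + (pos n + 1) - (pos n).+1 = n by lia.
- by [].
- rewrite /upd => p; case: eqP => [-> _|_]; last exact: rawS.
  by apply: raw1S; rewrite -[pos n]addn0 raw_done.
- by rewrite addn2 addn1.
- apply/funext => p; rewrite /upd.
  case: (ltngtP p (pos n)) => pn.
  + have -> : p < pos n + 2 by lia.
    have -> : (p == pos n + 1) = false by lia.
    have [->|pm] := pselect (p = m); first by rewrite !raw_flag.
    by rewrite !raw_near //; move: pn; rewrite /block_pos; lia.
  + case: eqP => [->|p1].
      have -> : pos n + 1 < pos n + 2 by lia.
      by rewrite raw_done.
    by have -> : (p < pos n + 2) = false by lia.
  + rewrite pn; have -> : pos n < pos n + 2 by lia.
    have -> : (pos n == pos n + 1) = false by lia.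
    by rewrite -[X in raw _ X]addn0 raw_done.
exact: reach_refl.
Qed.

(** The phase is cut right after the flag is set: the tape at the start of the second part then
    shows the flag, which is 0 again at the end of the phase. The other cells before [pos n] keep
    their values throughout. *)
Lemma phase_segment : exists A,
  [/\ segment (mk (BCheck P ord0) 0 (raw n)) A (mk (BCheck P ord0) 0 (raw n.+1)),
      forall i, A m i & forall p i, p <> m -> p < pos n -> (A p i <-> fresh p)].
Proof.
have [|A1 [s1 l1 u1]] := reach_neq_segment phase_flash; first by case.
have [||||||||A2 [s2 l2 u2]] := @shift_segment P s 4 (BShift P s) S
    (mk (BFlash P s) m.+1 (upd (raw n) m true)) (raw n) (raw n.+1) (pos n + 2)
    [tuple a n; false; false; false] => //.
(* The last of the four queued bits lands on [pos n.+1] and becomes the new terminator. *)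
- have e3 : pos n + 2 + 3 = pos n.+1 by rewrite /block_pos; lia.
  by rewrite /window /mkseq /= e3 raw_pos -!addnA !raw_done.
- move=> x px; rewrite !raw_far; [|lia|by move: px; rewrite /block_pos; lia].
  by congr a; move: px; rewrite /block_pos; lia.
- apply: reach_trans phase_unflash _; apply: reach_trans phase_insert.
  exact: phase_skip.
exists (fun p i => A1 p i \/ A2 p i); split.
- exact: segment_cat s1 s2.
- by move=> i; right; apply: l2; rewrite /= /upd eqxx.
- move=> p i pm pn; split=> [|fp]; last by left; apply: l1; rewrite /= raw_near.
  have pn1 : p < pos n.+1 by move: pn; rewrite /block_pos; lia.
  have Sf : S p -> fresh p by case=> [|[|//]]; rewrite raw_near.
  by case=> [/u1|/u2].
Qed.

End Phase.

(** The limit of the phases has flag 1, since every phase shows it; any other cell is settled once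
    the finished blocks have passed it. *)
Lemma setup_phases : exists A,
  segment (mk (BCheck P ord0) 0 (raw 0)) A (mk (BCheck P ord0) 0 fresh).
Proof.
have /choice[A HA] := phase_segment.
eexists; apply: (@segment_omega 1 PB (fun n => mk (BCheck P ord0) 0 (raw n)) A
  (fun p _ => fresh p)) => [n|p i]; first by case: (HA n).
have [->|pm] := pselect (p = m).
  by exists 0 => n _; split=> _; [exact: fresh_flag|case: (HA n)].
exists p => n pn; case: (HA n) => _ _; apply=> //.
by rewrite /block_pos; lia.
Qed.

Lemma setup_shift : exists A,
  segment (init1 PB a) A (mk (BCheck P ord0) 0 (raw 0)).
Proof.
have [||||||||A [sA _ _]] := @shift_segment P s m.+2 (@BShiftInit P s) (fun=> True)
    (init1 PB a) a (raw 0) 0 (Tuple (size_sentinels s)) => //.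
- apply: (@eq_from_nth _ false); first by rewrite size_mkseq (eqP (size_sentinels s)).
  move=> i; rewrite (eqP (size_sentinels s)) => im.
  rewrite nth_mkseq // add0n nth_cat; case: ltnP => [/raw_front->//|mi].
  have [->|->] : i = m \/ i = pos 0 by rewrite /block_pos; lia.
    by rewrite raw_flag subnn.
  rewrite raw_pos; have -> : pos 0 - m = 1 by rewrite /block_pos; lia.
  by [].
- move=> x _; rewrite raw_far; last by rewrite /block_pos; lia.
  by congr a; rewrite /block_pos; lia.
- exact: reach_refl.
by exists A.
Qed.

(** Column 0 of [fresh] has no mark, so [BResume] chooses [q_start P]; writing the mark turns
    [fresh] into the encoding of the initial tapes. *)
Lemma setup_enter : exists A, segment (mk (BCheck P ord0) 0 fresh) A
  (@sim_config 3 1 P PB (block_cell s) (@BSim P s) pos (init3 P a)).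
Proof.
have [||A [sA _ _]] := @reach_neq_segment 1 PB (fun _ _ => True)
    (mk (BCheck P ord0) 0 fresh)
    (@sim_config 3 1 P PB (block_cell s) (@BSim P s) pos (init3 P a)).
- apply: (reach_trans (c2 := mk (BCheck P (inord m)) m fresh)).
    by apply: (@breach_check P s (fun=> True)) => // p; apply: fresh_front.
  apply: (@breach_keep P s (fun=> True) _ _ _ _ (BEnter P s) true) => //.
    by rewrite /= inordK // ltnn fresh_flag.
  apply: (@breach_keep P s (fun=> True) _ _ _ _ (BResume P s) true) => //.
  have e1 : m.+2 = pos 0 + 1 by rewrite /block_pos; lia.
  apply: (@breach_step P s (fun=> True) _ _ _ _ (BSim s (q_start P)) true false
    (pos 0) (blocks s tin)) => //.
  + by rewrite e1 fresh_pos.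
  + by rewrite /block_pos muln0 addn0.
  + apply/funext => p; rewrite e1 /fresh /upd; case: eqP => // ->.
    by rewrite blocks_pos.
  exact: reach_refl.
- by case.
by exists A.
Qed.

Lemma block_setup : exists A, segment (init1 PB a) A
  (@sim_config 3 1 P PB (block_cell s) (@BSim P s) pos (init3 P a)).
Proof.
have [A1 s1] := setup_shift; have [A2 s2] := setup_phases.
have [A3 s3] := setup_enter.
by eexists; exact: segment_cat (segment_cat s1 s2) s3.
Qed.

End BlockSetup.

(** * Decoding *)

Section BlockFinish.
Context (P : program 3) (s : seq bool).

Local Notation m := (size s).
Local Notation PB := (block_machine P s).
Local Notation mk := (@mk P s).
Local Notation breach := (@breach P s).
Local Notation pos := (block_pos s).
Local Notation scfg := (@sim_config 3 1 P PB (block_cell s) (@BSim P s) pos).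

Lemma breach_clear (S : nat -> Prop) i (u : nat -> bool) :
  (forall p, S p) -> i <= m ->
  breach S (mk (BClear P (inord i)) i u) (mk (BGoRight P s) 1
    (fun p => if p == 0 then true else if p <= i then false else u p)).
Proof.
move=> ST; elim: i u => [|i IH] u im.
  apply: (breach_step (q' := BGoRight P s) (w := true) (r := true) (h' := 1)
    (t' := fun p => if p == 0 then true else if p <= 0 then false else u p)) => //.
  - by rewrite /= inordK.
  - by apply/funext => -[|p].
  exact: reach_refl.
apply: (breach_step (q' := BClear P (inord i)) (w := false) (r := false) (h' := i)
  (t' := upd u i.+1 false)) => //.
  by rewrite /= inordK.
have -> : (fun p => if p == 0 then true else if p <= i.+1 then false else u p) =
    (fun p => if p == 0 then true else if p <= i then false else upd u i.+1 false p).
  apply/funext => p; rewrite /upd [p <= i.+1]leq_eqVlt ltnS.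
  by case: eqP => // _; case: eqP => //= _; rewrite if_same.
by apply: IH; exact: ltnW.
Qed.

Lemma breach_right (S : nat -> Prop) h k (u : nat -> bool) :
  (forall p, u p -> S p) -> (forall j, j < k -> u (h + j) = false) ->
  breach S (mk (BGoRight P s) h u) (mk (BGoRight P s) (h + k) u).
Proof.
move=> uS; elim: k => [|k IH] u0; first by rewrite addn0; exact: reach_refl.
apply: reach_trans (IH _) _; first by move=> j jk; apply: u0; lia.
apply: (breach_keep (q' := BGoRight P s) (r := true) (h' := h + k.+1)) => //.
- by rewrite u0.
- by rewrite addnS.
exact: reach_refl.
Qed.

Lemma breach_left (S : nat -> Prop) b h k (u : nat -> bool) :
  (forall p, u p -> S p) -> (forall j, j < k -> u (h - j) = false) ->
  breach S (mk (BGoLeft P s b) h u) (mk (BGoLeft P s b) (h - k) u).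
Proof.
move=> uS; elim: k => [|k IH] u0; first by rewrite subn0; exact: reach_refl.
apply: reach_trans (IH _) _; first by move=> j jk; apply: u0; lia.
apply: (breach_keep (q' := BGoLeft P s b) (r := false) (h' := h - k.+1)) => //.
- by rewrite /= u0.
- by rewrite subnS.
exact: reach_refl.
Qed.

(** Of the [i + 1] erased cells the last one is remembered in [BGoLeft]. For [i = 3], right after
    the first cell of a block, it is the output bit. *)
Lemma breach_consume (S : nat -> Prop) i h (u : nat -> bool) :
  (forall p, u p -> S p) -> i < 4 ->
  breach S (mk (BConsume P s (inord i)) h u)
    (mk (BGoLeft P s (u (h + i))) (h + i).-1
      (fun p => if (h <= p) && (p <= h + i) then false else u p)).
Proof.
elim: i h u => [|i IH] h u uS i4.
  apply: (breach_step (q' := BGoLeft P s (u h)) (w := false) (r := false)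
    (h' := h.-1) (t' := upd u h false)) => //.
    by rewrite /= inordK.
  rewrite addn0; have -> : upd u h false =
      (fun p => if (h <= p) && (p <= h) then false else u p).
    by apply/funext => p; rewrite /upd; case: (ltngtP p h).
  exact: reach_refl.
apply: (breach_step (q' := BConsume P s (inord i)) (w := false) (r := true)
  (h' := h.+1) (t' := upd u h false)) => //.
  by rewrite /= inordK.
have uE : u (h + i.+1) = upd u h false (h.+1 + i).
  by rewrite addSnnS /upd; case: eqP => // ?; lia.
have -> : (fun p => if (h <= p) && (p <= h + i.+1) then false else u p) =
    (fun p => if (h.+1 <= p) && (p <= h.+1 + i) then false else upd u h false p).
  apply/funext => p; rewrite addSnnS /upd.
  case: (ltngtP h p) => //= <-; by rewrite leq_addr.
rewrite uE -addSnnS; apply: IH; last exact: ltnW.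
by move=> p; rewrite /upd; case: eqP => // _; exact: uS.
Qed.

Section Compress.
Context (t : nat -> 'I_3 -> bool).

Local Notation b := (fun n => t n tape_out).

(* The tape after [n] output bits: they are followed by a gap 1 0 ... 0 that
   ends where the first unread block starts. *)
Definition packed (n p : nat) : bool :=
  if p < n then b p else if p == n then true else
  if p < pos n then false else blocks s t p.

Lemma packed0E : (fun p => if p == 0 then true else
  if p <= m then false else blocks s t p) = packed 0.
Proof.
apply/funext => p; rewrite /packed /=; case: eqP => // _.
by rewrite /block_pos muln0 addn0 ltnS.
Qed.

Lemma breach_home h : breach (fun=> True)
  (mk (BHome P s) (pos h + 1) (blocks s t)) (mk (BHome P s) (pos 0 + 1) (blocks s t)).
Proof.
elim: h => [|h IH]; first exact: reach_refl.
apply: reach_trans IH.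
apply: (breach_keep (q' := walk s false 4 (inl false)) (r := false)
  (h' := pos h.+1)) => //.
- by rewrite blocks_pos.
- by rewrite addn1.
have -> : pos h + 1 = pos h.+1 - 4 by rewrite /block_pos; lia.
exact: (@breach_walk P s (fun=> True) false 4 (inl false) (pos h.+1)).
Qed.

Lemma breach_front h : breach (fun=> True)
  (mk (BSim s (q_halt P)) (pos h) (blocks s t)) (mk (BGoRight P s) 1 (packed 0)).
Proof.
apply: (breach_keep (q' := BHome P s) (r := true) (h' := pos h + 1)) => //.
- by rewrite /= eqxx.
- by rewrite addn1.
apply: reach_trans (breach_home h) _.
apply: (breach_keep (q' := BFront P s) (r := false) (h' := pos 0)) => //.
- by rewrite blocks_pos.
- by rewrite addn1.
apply: (breach_keep (q' := BClear P (inord m)) (r := false) (h' := m)) => //.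
  by rewrite /block_pos muln0 addn0.
by rewrite -packed0E; apply: breach_clear.
Qed.

(** One round: find the next 1, which starts block [n]; erase the block and remember its last cell;
    go back to the 1 at cell [n], replace it by the bit and put a new 1 at cell [n + 1]. The bound
    concerns the cells already output, whose values must survive to the limit. *)
Lemma breach_pack n : breach (fun p => p < n -> b p)
  (mk (BGoRight P s) n.+1 (packed n)) (mk (BGoRight P s) n.+2 (packed n.+1)).
Proof.
set S := fun p => _.
have npos : n < pos n by rewrite /block_pos; lia.
have pS p : packed n p -> S p.
  by rewrite /S /packed; case: ltnP.
pose u1 := upd (packed n) (pos n) false.
have u1S p : u1 p -> S p by rewrite /u1 /upd; case: eqP => // _; apply: pS.
pose u2 p := if (pos n + 1 <= p) && (p <= pos n + 4) then false else u1 p.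
have u2S p : u2 p -> S p by rewrite /u2; case: ifP => // _; apply: u1S.
have u2n : u2 n.
  rewrite /u2 /u1 /upd /packed ltnn eqxx.
  case: ifP => [|_]; first by lia.
  by case: eqP => //; lia.
have u2z p : n < p -> p < pos n.+1 -> u2 p = false.
  have e : pos n.+1 = pos n + 5 by rewrite /block_pos; lia.
  move=> np pp; rewrite /u2; case: ifP => // h; rewrite /u1 /upd.
  case: eqP => // h'; rewrite /packed.
  have -> : (p < n) = false by lia.
  have -> : (p == n) = false by lia.
  by have -> : p < pos n by lia.
apply: (reach_trans (c2 := mk (BGoRight P s) (pos n) (packed n))).
  have -> : pos n = n.+1 + (pos n - n.+1) by lia.
  apply: breach_right => // j jk; rewrite /packed.
  have -> : (n.+1 + j < n) = false by lia.
  have -> : (n.+1 + j == n) = false by lia.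
  by have -> : n.+1 + j < pos n by lia.
apply: (breach_step (q' := BConsume P s (inord 3)) (w := false) (r := true)
  (h' := pos n + 1) (t' := u1)) => //.
- rewrite /packed ltnNge (ltnW npos) /= ltnn blocks_pos0.
  by case: eqP => // e; lia.
- by rewrite addn1.
apply: (reach_trans (c2 := mk (BGoLeft P s (b n)) (pos n + 3) u2)).
  have := @breach_consume S 3 (pos n + 1) u1 u1S isT.
  have -> : pos n + 1 + 3 = pos n + 4 by lia.
  have -> : (pos n + 4).-1 = pos n + 3 by rewrite !addnS.
  suff -> : u1 (pos n + 4) = b n by [].
  rewrite /u1 /upd /packed blocks_pos //.
  have -> : (pos n + 4 == pos n) = false by lia.
  have -> : (pos n + 4 < n) = false by lia.
  have -> : (pos n + 4 == n) = false by lia.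
  by have -> : (pos n + 4 < pos n) = false by lia.
apply: (reach_trans (c2 := mk (BGoLeft P s (b n)) n u2)).
  have -> : mk (BGoLeft P s (b n)) n u2 =
      mk (BGoLeft P s (b n)) (pos n + 3 - (pos n + 3 - n)) u2.
    by congr Config; lia.
  apply: breach_left => // j jk; apply: u2z; first by lia.
  by move: jk; rewrite /block_pos; lia.
apply: (breach_step (q' := BPut P s) (w := b n) (r := true) (h' := n.+1)
  (t' := upd u2 n (b n))) => //.
  by rewrite /= u2n.
apply: (breach_step (q' := BGoRight P s) (w := true) (r := true) (h' := n.+2)
  (t' := packed n.+1)) => //.
- by move=> p; rewrite /upd; case: eqP => [-> _|_]; [rewrite /S ltnn|exact: u2S].
- apply/funext => p; rewrite /upd {1}/packed ltnS.
  have e : pos n.+1 = pos n + 5 by rewrite /block_pos; lia.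
  case: (p =P n.+1) => [->|pn1]; first by rewrite ltnn.
  case: (ltngtP p n) => [pn|np|->] //.
    rewrite /u2 /u1 /upd /packed pn.
    case: ifP => [|_]; first by lia.
    by case: eqP => [|//]; lia.
  case: ltnP => pp; first by rewrite u2z.
  rewrite /u2 /u1 /upd /packed.
  have -> : (pos n + 1 <= p) && (p <= pos n + 4) = false by lia.
  have -> : (p == pos n) = false by lia.
  have -> : (p < n) = false by lia.
  have -> : (p == n) = false by lia.
  by have -> : (p < pos n) = false by lia.
exact: reach_refl.
Qed.

(** Cell [p] shows just its output bit from round [p + 1] on, so the limit tape is the output
    alone. *)
Lemma pack_segment : exists A,
  segment (mk (BGoRight P s) 1 (packed 0)) A (mk (BCheck P ord0) 0 b).
Proof.
have H n : exists A, [/\ segment (mk (BGoRight P s) n.+1 (packed n)) A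
      (mk (BGoRight P s) n.+2 (packed n.+1)),
    forall p i, packed n p -> A p i & forall p i, A p i -> p < n -> b p].
  have [|A [sA lA uA]] := reach_neq_segment (breach_pack n).
    by case=> /eqP; rewrite eqn_leq ltnn andbF.
  by exists A.
have /choice[A HA] := H.
eexists; apply: (@segment_omega 1 PB
  (fun n => mk (BGoRight P s) n.+1 (packed n)) A (fun p _ => b p)) => [n|p i].
  by case: (HA n).
exists p.+1 => n pn; case: (HA n) => _ lA uA; split=> [/uA|bp]; first exact.
by apply: lA; rewrite /packed pn.
Qed.

(** [BCheck] only reads up to the first cell where [b] departs from [s], and halts there with the
    tape intact. *)
Lemma reject_segment : (exists2 i, i < m & b i != nth false s i) ->
  exists h A, segment (mk (BCheck P ord0) 0 b) A (mk (BHalt P s) h b).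
Proof.
move=> [i0 i0m bi0].
have ex : exists i, (i < m) && (b i != nth false s i) by exists i0; rewrite i0m.
have [i /andP[im bi] imin] := ex_minnP ex.
exists i.+1; have [||A [sA _ _]] := @reach_neq_segment 1 PB (fun _ _ => True)
    (mk (BCheck P ord0) 0 b) (mk (BHalt P s) i.+1 b).
- apply: (reach_trans (c2 := mk (BCheck P (inord i)) i b)).
    apply: (@breach_check P s (fun=> True)) => //; first exact: ltnW.
    move=> p pi; apply/eqP/negPn/negP => bp.
    have := imin p; rewrite bp (ltn_trans pi im) leqNgt pi => /(_ isT).
    by [].
  apply: (@breach_keep P s (fun=> True) _ _ _ _ (BHalt P s) true) => //.
    rewrite /= inordK; last by rewrite ltnS ltnW.
    by rewrite im (negPf bi).
  exact: reach_refl.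
- by case.
by exists A.
Qed.

End Compress.

Lemma block_finish c c' : Defs.cst c = q_halt P ->
  @sim_entry 3 1 P PB (block_cell s) (@BSim P s) pos c c' ->
  (exists2 i, i < m & ctape c i tape_out != nth false s i) ->
  exists fin A, [/\ segment c' A fin, Defs.cst fin = BHalt P s
    & forall n, ctape fin n ord0 = ctape c n tape_out].
Proof.
move=> hc ec hb.
have H0 : breach (fun=> True) (scfg c) (mk (BGoRight P s) 1 (packed (ctape c) 0)).
  by case: c hc {ec hb} => q h t /= ->; exact: breach_front.
have H : breach (fun=> True) c' (mk (BGoRight P s) 1 (packed (ctape c) 0)).
  case: ec => [->//|[t [ct ->]]]; rewrite ct in H0 *.
  by apply: reach_trans H0; apply: breach_limit_entry.
have [|A1 [s1 _ _]] := reach_neq_segment H.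
  by case: ec => [->|[t [_ ->]]]; case.
have [A2 s2] := pack_segment (ctape c).
have [h [A3 s3]] := reject_segment hb.
exists (mk (BHalt P s) h (fun n => ctape c n tape_out)); eexists; split=> //.
exact: segment_cat (segment_cat s1 s2) s3.
Qed.

End BlockFinish.

Lemma one_tape_of_ittm (f : (nat -> bool) -> option (nat -> bool)) (s : seq bool) :
  (forall a b, f a = Some b -> exists2 i, i < size s & b i != nth false s i) ->
  (exists P : program 3, forall a b, ittm_computes P a b <-> f a = Some b) ->
  exists P : program 1, forall a b, ittm1_computes P a b <-> f a = Some b.
Proof.
move=> fs [P fP]; exists (block_machine P s) => a b.
have [A0 s0] := block_setup P s a.
have fwd b' : f a = Some b' -> ittm1_computes (block_machine P s) a b'.
  move=> fab; have := fab => /fP[fin [hfin fb]].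
  have [c' [A [ec sc]]] := simulation_halts (@block_block P s) s0 hfin.
  have hf : Defs.cst fin = q_halt P by case/halting_runP: hfin.
  have [|fin' [B [sB hfin' out]]] := block_finish hf ec.
    (* This is where the word [s] is needed: the decoded output, being a value of [f], differs from
       [s] somewhere, so the limit that ends the decoding is recognised. *)
    by have [i im bi] := fs _ _ fab; exists i; rewrite -?fb.
  exists fin'; split; last by move=> n; rewrite fb out.
  exact: segment_halting (segment_cat sc sB) hfin'.
split; last exact: fwd.
move=> [fin' [hfin' fb]].
have [fin hfin] := simulation_halts_inv (@block_block P s) s0 hfin'.
have fa : f a = Some (fun n => ctape fin n tape_out) by apply/fP; exists fin.
have [fin2 [hfin2 fb2]] := fwd _ fa.
rewrite fa; congr Some; apply/funext => n.
by rewrite fb fb2 (halting_run_uniq hfin' hfin2).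
Qed.

(** * Avoiding an open set of Cantor space *)

(** The topology is the supremum of those pulled back along the coordinates, so convergence is
    checked in one coordinate at a time, where the sequence is eventually constant. *)
Lemma cvg_cantor_agree (y : nat -> cantor_space) (x : cantor_space) :
  (forall k i, i < k -> y k i = x i) -> (y @ \oo --> x)%classic.
Proof.
move=> yx; apply/cvg_sup => i U [/= _ [[V oV <-] /= Vx]] /filterS; apply.
by exists i.+1 => // k ik; rewrite /preimage/= yx.
Qed.

(** Let [x] lie in an open set missing [S]. If every prefix of [x] had an extension in [S], these
    extensions would converge to [x] and enter the open set; so some prefix of [x] has none. *)
Lemma not_dense_avoids_prefix (S : set cantor_space) : ~ dense S ->
  exists s : seq bool,
    forall y, S y -> exists2 i, i < size s & y i != nth false s i.
Proof.
move=> /denseNE[W [[x [oW Wx]] WS]]; apply: contrapT => /forallNP ns.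
have /choice[y Hy] : forall k, exists y : cantor_space,
    S y /\ forall i, i < k -> y i = x i.
  move=> k; apply: contrapT => /forallNP ny; apply: (ns (mkseq x k)) => y Sy.
  apply: contrapT => H; apply: (ny y); split=> // i ik.
  apply/eqP/negPn/negP => yx; apply: H; exists i; first by rewrite size_mkseq.
  by rewrite nth_mkseq.
have /cvg_cantor_agree/(_ W) : forall k i, i < k -> y k i = x i.
  by move=> k i; case: (Hy k) => _; apply.
case=> [|k _ /(_ k (leqnn k)) Wk]; first exact: open_nbhs_nbhs.
by have : (W `&` S)%classic (y k); [split=> //; case: (Hy k)|rewrite WS].
Qed.

Theorem mainTheorem4 (f : pfun) :
  ~ dense (prange f) -> (ittm_computable f <-> one_tape_computable f).
Proof.
move=> /not_dense_avoids_prefix[s fs]; split; last exact: ittm_of_one_tape.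
by apply: (@one_tape_of_ittm f s) => a b fab; apply: fs; exists a.
Qed.
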